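(* Let $r\in(-1,\infty)$ and $K\in\{2,3,\dots\}$. The merging function $(r+1)^{1/r}M_{r,K}$ on $[0,1]^K$ is precise if and only if $r\in\left[\frac{1}{K-1},K-1\right]$. Here $(r+1)^{1/r}$ is understood as $e$ when $r=0$.
   Context: Generalized means on $[0,1]^K$: for $r\in\mathbb{R}\setminus\{0\}$, $M_{r,K}(p_1,\dots,p_K):=\left(\frac{p_1^r+\dots+p_K^r}{K}\right)^{1/r}$, with conventions $0^c:=\infty$ for $c<0$, $0^c:=0$ for $c>0$, $\infty+c:=\infty$, $\infty^c:=0$ for $c<0$; $M_{0,K}(p_1,\dots,p_K):=\left(\prod_{k=1}^K p_k\right)^{1/K}$. Fix an atomless probability space and let $\mathcal{U}$ be the set of all random variables on it uniformly distributed on $[0,1]$. A merging function is a Borel function $F:[0,1]^K\to[0,\infty)$, increasing (in the weak sense) in each argument, such that for each $\epsilon\in(0,1)$, $\sup\{\mathbb{P}(F(U_1,\dots,U_K)\le\epsilon)\mid U_1,\dots,U_K\in\mathcal{U}\}\le\epsilon$. It is precise if this supremum equals $\epsilon$ for each $\epsilon\in(0,1)$. (For $r\in(-1,\infty)$ the function $(r+1)^{1/r}M_{r,K}$ is a merging function.) *)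

(* Defs.v *)
From HB Require Import structures.
From mathcomp Require Import all_boot all_order all_algebra.
From mathcomp Require Import all_classical all_reals all_analysis.

Set Implicit Arguments.
Unset Strict Implicit.
Unset Printing Implicit Defensive.

Import Order.TTheory GRing.Theory Num.Theory.
Import numFieldNormedType.Exports.

Local Open Scope classical_set_scope.
Local Open Scope ring_scope.

(* Powers on [0, +oo] with 0^c = +oo and +oo^c = 0 for c < 0. This differs from
   powR and poweR, for which 0^c = 0 and +oo^c = +oo when c < 0. The value at
   -oo is junk and never used. *)
Definition xpow (R : realType) (x : \bar R) (c : R) : \bar R :=
  match x with
  | a%:E => if (a == 0) && (c < 0) then +oo%E else (a `^ c)%:E
  | +oo%E => if c < 0 then 0%E else +oo%E
  | -oo%E => 0%E
  end.

(* For r != 0 the intermediate sum may be +oo (if r < 0 and some p_k = 0), but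
   the value of the mean is finite for every p in [0,1]^K, so that [fine]
   loses nothing there. *)
Definition gen_mean (R : realType) (K : nat) (r : R) (p : K.-tuple R) : R :=
  if r == 0 then (\prod_(k < K) tnth p k) `^ (K%:R^-1)
  else fine (xpow ((\sum_(k < K) xpow (tnth p k)%:E r) * (K%:R^-1)%:E)%E r^-1).

Definition mean_const (R : realType) (r : R) : R :=
  if r == 0 then expR 1 else (r + 1) `^ r^-1.

Definition unit_cube (R : realType) (K : nat) : set (K.-tuple R) :=
  [set p | forall k, 0 <= tnth p k <= 1].

Definition atomless (d : measure_display) (T : measurableType d)
    (R : realType) (P : probability T R) : Prop :=
  forall A : set T, measurable A -> (0 < P A)%E ->
    exists B : set T,
      [/\ measurable B, B `<=` A, (0 < P B)%E & (P B < P A)%E].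

(* The values are required to lie in [0,1] everywhere, so that F(U_1, ..., U_K)
   makes sense for a function F on [0,1]^K. *)
Definition uniform01 (d : measure_display) (T : measurableType d)
    (R : realType) (P : probability T R) (U : {RV P >-> R}) : Prop :=
  (forall w, 0 <= U w <= 1) /\
  (forall A : set R, measurable A ->
     distribution P U A = uniform_prob (@ltr01 R) A).

Definition worst_case_prob (d : measure_display) (T : measurableType d)
    (R : realType) (P : probability T R) (K : nat)
    (F : K.-tuple R -> R) (eps : R) : \bar R :=
  ereal_sup [set x | exists2 U : 'I_K -> {RV P >-> R},
    (forall k, uniform01 (U k)) &
    x = P [set w | F [tuple U k w | k < K] <= eps]].

(* A function on [0,1]^K is represented by a function on R^K of which only the
   values on the cube matter. *)
Definition merging_function (d : measure_display) (T : measurableType d)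
    (R : realType) (P : probability T R) (K : nat)
    (F : K.-tuple R -> R) : Prop :=
  [/\ measurable_fun (@unit_cube R K) F,
      (forall p, unit_cube p -> 0 <= F p),
      (forall (p q : K.-tuple R) (k : 'I_K), unit_cube p -> unit_cube q ->
         (forall j, j != k -> tnth p j = tnth q j) ->
         tnth p k <= tnth q k -> F p <= F q) &
      (forall eps : R, 0 < eps < 1 -> (worst_case_prob P F eps <= eps%:E)%E)].

Definition precise (d : measure_display) (T : measurableType d)
    (R : realType) (P : probability T R) (K : nat)
    (F : K.-tuple R -> R) : Prop :=
  forall eps : R, 0 < eps < 1 -> worst_case_prob P F eps = eps%:E.

(* Main.v *)
Require Import Defs.
From HB Require Import structures.
From mathcomp Require Import all_boot all_order all_algebra.
From mathcomp Require Import all_classical all_reals all_analysis.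
From mathcomp Require Import measurable_realfun.
From mathcomp Require Import ring lra zify.

(** Let L_r(w) = (w^r - 1)/r, read as ln w when r = 0.  For F = (r+1)^(1/r) M_(r,K),
    the inequality F(p) <= eps says that the L_r(p_k / eps) have mean at most
    -1/(r+1), which is also the integral of L_r over [0, 1].

    Upper bounds.  Markov's inequality for the sum of the positive parts of
    -L_r(U_k / eps) gives P(F <= eps) <= eps, so F is a merging function.  If
    r < 1/(K-1), then b = K/(r+1) is below the supremum of -L_r; truncating the
    test function at the level b keeps the sum at least b on the event and
    strictly lowers the expectation, so F is not precise ([prob_mean_lt]).  If
    r > K-1, then K/(r+1) < 1 and F <= eps forces every U_k below a fixed
    fraction of eps ([prob_mean_le_large]).

    Lower bound for 1/(K-1) <= r <= K-1.  On an event of probability eps one wants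
    variables U_k, uniform on [0, eps] given that event, whose (U_k / eps)^r add up
    to the constant K/(r+1).  Let W be uniform on [0, 1].  The law of W^r if r >= 1,
    and that of 1 - W^r if r <= 1, has a decreasing density on [0, 1] and a mean of
    at least 1/K; such laws are jointly mixable (Wang and Wang).  Precision is a
    statement about a supremum, so it is enough to mix approximately:

    - The law is replaced by one that is uniform between consecutive points of a
      grid whose gaps increase.

    - By approachability ([approachability]), there are finitely many K-tuples in
      [0, 1]^K with the prescribed sum whose pooled entries imitate that law, as
      soon as every single test function g admits one such tuple for which the
      average of g over the entries is at least its mean under the law.

    - For a given g ([test_tuple]), let H(s) be the mean of g over [0, s], and take
      the tangent at twice the mean of the law to the concave envelope of H; it
      touches H at two points s <= t.  Adding an affine function to g changes both
      sides of the wanted inequality equally, and so g can be replaced by a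
      function e whose primitive E is at most 0 on [0, 1] and vanishes at s and t.
      The law is a mixture of uniform laws on intervals [0, x], so e has a
      nonpositive mean.  It remains to find a tuple on which e has a nonnegative
      sum ([balanced_tuple]): let the coordinates move affinely, with a constant
      sum, in such a way that the means of e along their ways have a nonnegative
      sum; mostly, every single one is nonnegative because the way has s or t as its
      right end.  The mean value theorem yields a suitable point of the path.

    - Replacing the pooled entries by their ranks, and shifting the rows cyclically,
      gives permutations of finitely many cells ([latin_array]).  Each of them acts
      on one uniform variable as an interval exchange ([interval_exchange]).  That
      variable exists on every atomless space ([sierpinski], [exists_uniform]). *)

Set Implicit Arguments.
Unset Strict Implicit.
Unset Printing Implicit Defensive.

Import Order.TTheory GRing.Theory Num.Theory.
Import numFieldNormedType.Exports.

Local Open Scope classical_set_scope.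
Local Open Scope ring_scope.

(** * Tuples of given sum with a nonnegative test sum *)

Section MeanSlopes.
Variable R : realType.
Implicit Types (E e : R -> R) (x d c th : R) (K : nat).

Definition primitive E e := forall x : R, is_derive x (1 : R) E (e x).

Lemma is_derive_affine E e x d th : primitive E e ->
  is_derive th (1 : R) (fun z : R => E (x + d * z)) (d * e (x + d * th)).
Proof.
move=> dE.
have h : is_derive th (1 : R) (fun z : R => x + d * z) d.
  have := @is_deriveD R R R (cst x) (fun z : R => d *: z) th 1 0 d (is_derive_cst _ _ _).
  rewrite add0r; apply.
  by have := @is_deriveZ R R R id d th 1 1 (is_derive_id _ _); rewrite [d *: 1]mulr1.
by have := @is_derive1_comp R E _ th _ _ (dE (x + d * th)) h; rewrite mulrC.
Qed.

(** The mean of e over the segment from x to x + d, for E a primitive of e. *)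
Definition mean_slope E e x d : R := if d == 0 then e x else (E (x + d) - E x) / d.

(** A list of blocks (n, x, d) is a path of tuples: n coordinates start together at
    x at time 0 and reach x + d at time 1. *)
Definition block_values (bs : seq (nat * R * R)) th : seq R :=
  flatten [seq nseq b.1.1 (b.1.2 + b.2 * th) | b <- bs].

Lemma sum_block_values (f : R -> R) (bs : seq (nat * R * R)) th :
  \sum_(x <- block_values bs th) f x = \sum_(b <- bs) b.1.1%:R * f (b.1.2 + b.2 * th).
Proof.
rewrite big_flatten /= big_map; apply: eq_bigr => b _.
by rewrite big_nseq -Monoid.iteropE /= mulr_natl.
Qed.

(** The sum of e along the path is the derivative in time of the sum of the
    E (x + d th) / d, so the mean value theorem applies. *)
Lemma mean_slope_attained E e (bs : seq (nat * R * R)) :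
  primitive E e ->
  exists2 th, 0 <= th <= 1 &
    \sum_(b <- bs) b.1.1%:R * mean_slope E e b.1.2 b.2 <=
    \sum_(x <- block_values bs th) e x.
Proof.
move=> dE.
pose prim (b : nat * R * R) th :=
  if b.2 == 0 then e b.1.2 * th else (b.2)^-1 * E (b.1.2 + b.2 * th).
pose Phi th := \sum_(b <- bs) b.1.1%:R * prim b th.
pose phi th := \sum_(b <- bs) b.1.1%:R * e (b.1.2 + b.2 * th).
have dprim (b : nat * R * R) th : is_derive th (1:R) (prim b) (e (b.1.2 + b.2 * th)).
  rewrite /prim; case: eqVneq => [b0|b0].
    rewrite b0 mul0r addr0.
    by have := @is_deriveZ R R R id (e b.1.2) th 1 1 (is_derive_id _ _); rewrite [_ *: 1]mulr1.
  have := @is_deriveZ R R R _ (b.2)^-1 th 1 _ (is_derive_affine b.1.2 b.2 th dE).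
  by rewrite [_ *: (_ * _)]mulrA mulVf// mul1r.
have dPhi th : is_derive th (1:R) Phi (phi th).
  rewrite /Phi /phi; elim: (bs) => [|b s IH].
    have -> : (fun z => \sum_(b <- [::]) b.1.1%:R * prim b z) = cst 0.
      by apply/funext => z; rewrite big_nil.
    by rewrite big_nil; exact: is_derive_cst.
  have -> : (fun z => \sum_(a <- b :: s) a.1.1%:R * prim a z) =
      (fun z => b.1.1%:R * prim b z) + (fun z => \sum_(a <- s) a.1.1%:R * prim a z).
    by apply/funext => z; rewrite big_cons.
  rewrite big_cons; exact: (is_deriveD (is_deriveZ _ (dprim _ th)) IH).
have [|th th01 hth] := @MVT R Phi phi 0 1 ltr01 (fun x _ => dPhi x).
  by apply: derivable_within_continuous => x _; have [] := dPhi x.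
exists th; first by move: th01; rewrite in_itv /= => /andP[/ltW -> /ltW ->].
rewrite sum_block_values -/(phi th).
move: hth; rewrite subr0 mulr1 => <-.
rewrite /Phi -sumrB; apply: ler_sum => b _; rewrite -mulrBr ler_wpM2l//.
rewrite /mean_slope /prim; case: eqP => _; first by rewrite mulr1 mulr0 subr0.
by rewrite mulr1 mulr0 addr0 -mulrBr mulrC.
Qed.

(** The form in which the mean value theorem is used below: the total displacement
    vanishes, so that the sum of the coordinates stays equal to c. *)
Lemma tuple_of_blocks E e K c (bs : seq (nat * R * R)) :
  primitive E e ->
  (\sum_(b <- bs) b.1.1 = K)%N ->
  \sum_(b <- bs) b.1.1%:R * b.1.2 = c ->
  \sum_(b <- bs) b.1.1%:R * b.2 = 0 ->
  (forall b, b \in bs -> 0 <= b.1.2 <= 1 /\ 0 <= b.1.2 + b.2 <= 1) ->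
  0 <= \sum_(b <- bs) b.1.1%:R * mean_slope E e b.1.2 b.2 ->
  exists v : seq R, [/\ size v = K, {in v, forall x, 0 <= x <= 1},
    \sum_(x <- v) x = c & 0 <= \sum_(x <- v) e x].
Proof.
move=> dE sK sc sd hb h0.
have [th /andP[th0 th1] hth] := mean_slope_attained bs dE.
exists (block_values bs th); split.
- rewrite size_flatten /shape -map_comp sumnE big_map -sK.
  by apply: eq_bigr => b _ /=; rewrite size_nseq.
- move=> x /flatten_mapP[b bbs]; rewrite mem_nseq => /andP[_ /eqP ->].
  move: (hb _ bbs); move: (b.1.2) (b.2) => y d [/andP[? ?] /andP[? ?]].
  by apply/andP; split; nra.
- have /= -> := sum_block_values id bs th.
  rewrite (eq_bigr (fun b : nat * R * R => b.1.1%:R * b.1.2 + b.1.1%:R * b.2 * th)).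
    by rewrite big_split /= -mulr_suml sc sd mul0r addr0.
  by move=> b _; rewrite mulrDr mulrA.
- exact: le_trans hth.
Qed.

Lemma mean_slope_ge0 E e x d : (d = 0 -> 0 <= e x) -> (0 < d -> E x <= E (x + d)) ->
  (d < 0 -> E (x + d) <= E x) -> 0 <= mean_slope E e x d.
Proof.
move=> h0 hp hn; rewrite /mean_slope; case: eqVneq => [/h0 //|_].
have [d0|d0|d0] := ltgtP d 0; last by rewrite d0 invr0 mulr0.
  rewrite -mulrNN -invrN mulr_ge0// ?invr_ge0 oppr_ge0 ?(ltW d0)//.
  by rewrite subr_le0; exact: hn.
rewrite mulr_ge0// ?invr_ge0 ?(ltW d0)// subr_ge0.
exact: hp.
Qed.

(** Joint mix of K uniform laws on the interval [2 mu - s, s]: pairs of coordinates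
    that move in opposite directions and, if K is odd, one triple, which moves from
    (s, 2 mu - s, mu) to (mu, s, 2 mu - s).  The latter is one of three segments that
    are exchanged by cyclic permutations; one is enough, since e is the same for all
    coordinates. *)
Lemma symmetric_tuple E e K s c mu : primitive E e -> (2 <= K)%N ->
  K%:R * mu = c -> 0 <= s <= 1 -> mu <= s <= 2 * mu ->
  E (2 * mu - s) <= E s -> (s = mu -> 0 <= e s) ->
  exists v : seq R, [/\ size v = K, {in v, forall x, 0 <= x <= 1},
    \sum_(x <- v) x = c & 0 <= \sum_(x <- v) e x].
Proof.
move=> dE K2 Kmu /andP[s0 s1] /andP[mus s2mu] Es es.
(* o triples (none or one) and h pairs *)
pose o : nat := odd K; pose h := (K - 3 * o)./2.
have hK : (K = h.*2 + 3 * o)%N.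
  have := odd_double_half (K - 3 * o); rewrite -/h /o.
  by case: (boolP (odd K)) => oK; lia.
pose rho := s - mu.
have slope3 : 0 <= mean_slope E e s (- rho) + mean_slope E e (2 * mu - s) (2 * rho)
                 + mean_slope E e mu (- rho).
  rewrite /mean_slope oppr_eq0 mulf_eq0 pnatr_eq0 /=.
  case: eqVneq => [/eqP|rho0].
    rewrite subr_eq0 => /eqP smu.
    have -> : 2 * mu - s = mu by rewrite smu; ring.
    by rewrite -smu !addr_ge0 ?es.
  have -> : s - rho = mu by rewrite /rho; ring.
  have -> : 2 * mu - s + 2 * rho = s by rewrite /rho; ring.
  have -> : mu - rho = 2 * mu - s by rewrite /rho; ring.
  have -> : (E mu - E s) / - rho + (E s - E (2 * mu - s)) / (2 * rho) +
     (E (2 * mu - s) - E mu) / - rho = (3 / 2) * ((E s - E (2 * mu - s)) / rho).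
    by field; rewrite rho0.
  by rewrite mulr_ge0// mulr_ge0 ?subr_ge0// invr_ge0 subr_ge0.
apply: (@tuple_of_blocks E e K c [:: (h, s, - (2 * rho)); (h, 2 * mu - s, 2 * rho);
  (o, s, - rho); (o, 2 * mu - s, 2 * rho); (o, mu, - rho)]) => //.
- by rewrite !big_cons big_nil /=; lia.
- by rewrite !big_cons big_nil /= -Kmu hK natrD natrM -addnn natrD; ring.
- by rewrite !big_cons big_nil /=; ring.
- by move=> b; rewrite !inE => /or4P[/eqP|/eqP|/eqP|/orP[]/eqP] -> /=;
    rewrite /rho; split; apply/andP; split; lra.
- rewrite !big_cons big_nil /=.
  set m1 := mean_slope _ _ _ _; set m2 := mean_slope _ _ _ _.
  set m3 := mean_slope _ _ _ _ in slope3 *; set m4 := mean_slope _ _ _ _ in slope3 *.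
  set m5 := mean_slope _ _ _ _ in slope3 *.
  have -> : h%:R * m1 + (h%:R * m2 + (o%:R * m3 + (o%:R * m4 + (o%:R * m5 + 0)))) =
    h%:R * m1 + h%:R * m2 + o%:R * (m3 + m4 + m5) by ring.
  rewrite addr_ge0 ?mulr_ge0// addr_ge0// mulr_ge0//; apply: mean_slope_ge0.
  + by move=> h0; apply: es; move: h0; rewrite /rho => ?; lra.
  + by rewrite /rho => ?; exfalso; lra.
  + move=> _; suff -> : s - 2 * rho = 2 * mu - s by [].
    by rewrite /rho; ring.
  + move=> h0; have smu : s = mu by move: h0; rewrite /rho => ?; lra.
    suff -> : 2 * mu - s = s by exact: es.
    by rewrite smu; ring.
  + move=> _; suff -> : 2 * mu - s + 2 * rho = s by [].
    by rewrite /rho; ring.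
  + by rewrite /rho => ?; exfalso; lra.
Qed.

(** Apart from the symmetric case, every coordinate runs over an interval whose right
    end is s or t, where E attains its maximum 0, so that e has a nonnegative mean
    over it. *)
Lemma balanced_tuple E e K s t c : primitive E e -> (2 <= K)%N ->
  (forall x, 0 <= x <= 1 -> E x <= 0) -> E s = 0 -> E t = 0 -> 0 <= e s -> 0 <= e t ->
  0 <= s -> K%:R * s <= 2 * c -> 2 * c <= K%:R * t -> t <= 1 -> 1 <= c ->
  exists v : seq R, [/\ size v = K, {in v, forall x, 0 <= x <= 1},
    \sum_(x <- v) x = c & 0 <= \sum_(x <- v) e x].
Proof.
move=> dE K2 E0 Es Et es et s0 s2c c2t t1 c1.
have K0 : 0 < K%:R :> R by rewrite ltr0n ltnW.
have st : s <= t by rewrite -(ler_pM2l K0); lra.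
have [sc|sc] := lerP c (K%:R * s).
  pose mu := c / K%:R.
  have Kmu : K%:R * mu = c by rewrite /mu mulrC divfK// gt_eqF.
  have mus : mu <= s <= 2 * mu.
    by rewrite -(ler_pM2l K0) -(ler_pM2l K0 s) Kmu mulrCA Kmu sc s2c.
  apply: (@symmetric_tuple E e K s c mu) => //.
  - by rewrite s0 (le_trans st).
  - by rewrite Es E0//; case/andP: mus => ? ?; apply/andP; split; lra.
have t0 : 0 < t by rewrite -(ltr_pM2l K0) mulr0; lra.
(* Now K s < c: some coordinates must end at t.  The number j is the largest one for
   which j coordinates equal to t do not exceed the sum c. *)
pose j := Num.truncn (c / t).
have /andP[jc cj] : j%:R * t <= c < (j%:R + 1) * t.
  have := truncn_itv (divr_ge0 (le_trans ler01 c1) (ltW t0)).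
  by rewrite -/j ler_pdivlMr// ltr_pdivrMr// -natr1.
have j0 : (0 < j)%N by rewrite /j truncn_gt0 ler_pdivlMr// mul1r; lra.
clearbody j.
have jK : (j < K)%N.
  rewrite -(ltr_nat R) -(ltr_pM2r t0); apply: (le_lt_trans jc); lra.
have j1 : 1 <= j%:R :> R by rewrite ler1n.
have jn0 : j%:R != 0 :> R by rewrite pnatr_eq0 -lt0n.
have Kj : (K - j)%:R = K%:R - j%:R :> R by rewrite natrB// ltnW.
have Kj1 : 1 <= (K - j)%:R :> R by rewrite ler1n subn_gt0.
have Kjn0 : (K - j)%:R != 0 :> R by rewrite gt_eqF// (lt_le_trans ltr01).
have [cjs|cjs] := lerP c (j%:R * t + (K - j)%:R * s).
  (* j coordinates come down from t by L / j each while the others climb to s; L is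
     what must be subtracted from the right ends to reach the sum c *)
  pose L := j%:R * t + (K - j)%:R * s - c.
  have L0 : 0 <= L by rewrite /L; lra.
  have Lt : 0 <= L / j%:R <= t.
    rewrite divr_ge0//= ler_pdivrMr ?ltr0n// mulrC /L Kj.
    have : 0 <= j%:R * s by rewrite mulr_ge0.
    by lra.
  have Ls : 0 <= L / (K - j)%:R <= s.
    rewrite divr_ge0//= ler_pdivrMr ?ltr0n ?subn_gt0// mulrC /L; lra.
  apply: (@tuple_of_blocks E e K c [:: (j, t, - (L / j%:R));
     ((K - j)%N, s - L / (K - j)%:R, L / (K - j)%:R)]) => //.
  - by rewrite !big_cons big_nil /=; clear -jK; lia.
  - by rewrite !big_cons big_nil /= /L; field.
  - by rewrite !big_cons big_nil /= addr0 mulrN mulrC divfK// (mulrC (K - j)%:R) divfK// addNr.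
  - by move: Lt Ls => /andP[? ?] /andP[? ?] b; rewrite !inE => /orP[]/eqP -> /=;
     split; apply/andP; split; lra.
  - move: Lt Ls => /andP[? ?] /andP[? ?]; rewrite !big_cons big_nil /= addr0.
    rewrite addr_ge0// mulr_ge0//; apply: mean_slope_ge0.
    + by [].
    + by move=> ?; exfalso; lra.
    + by move=> _; rewrite Et E0//; apply/andP; split; lra.
    + by move=> ->; rewrite subr0.
    + by move=> _; rewrite subrK Es E0//; apply/andP; split; lra.
    + by move=> ?; exfalso; lra.
have KJ : (K - j.+1)%:R = K%:R - j%:R - 1 :> R by rewrite natrB// -natr1 opprD addrA.
have KJ0 : 0 <= (K - j.+1)%:R :> R by [].
(* With j coordinates near t the sum c is out of reach.  With j + 1 of them the
   K - j - 1 coordinates below s cover all of [0, s], and one coordinate that ends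
   at t moves along with them, against the j others. *)
pose L := (j%:R + 1) * t + (K - j.+1)%:R * s - c.
have KJs : 0 <= (K - j.+1)%:R * s by rewrite mulr_ge0.
have L0 : 0 <= L by rewrite /L; lra.
have Lt : 0 <= L / j%:R <= t.
  rewrite divr_ge0//= ler_pdivrMr ?ltr0n// mulrC /L.
  have : (K - j.+1)%:R * s + t <= c.
    have : t <= j%:R * t by rewrite ler_peMl// ltW.
    by move: cjs; rewrite Kj KJ; lra.
  by lra.
apply: (@tuple_of_blocks E e K c [:: (1%N, c - j%:R * t, (j%:R + 1) * t - c);
  ((K - j.+1)%N, 0, s); (j, t, - (L / j%:R))]) => //.
- by rewrite !big_cons big_nil /=; clear -jK; lia.
- by rewrite !big_cons big_nil /=; ring.
- by rewrite !big_cons big_nil /= /L; field.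
- by move: Lt => /andP[? ?] b; rewrite !inE => /or3P[]/eqP -> /=;
    split; apply/andP; split; lra.
- move: Lt => /andP[? ?]; rewrite !big_cons big_nil /= addr0.
  rewrite addr_ge0// ?mul1r; last rewrite addr_ge0// mulr_ge0//.
  + apply: mean_slope_ge0.
    * by move=> ?; suff -> : c - j%:R * t = t by []; lra.
    * move=> _; have -> : c - j%:R * t + ((j%:R + 1) * t - c) = t by ring.
      by rewrite Et E0//; apply/andP; split; lra.
    * by move=> ?; exfalso; lra.
  + apply: mean_slope_ge0; rewrite ?add0r => hs.
    * by move: es; rewrite hs.
    * by rewrite Es E0// lexx ler01.
    * by move: hs; rewrite ltNge s0.
  + apply: mean_slope_ge0 => //.
    * by move=> ?; exfalso; lra.
    * by move=> _; rewrite Et E0//; apply/andP; split; lra.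
Qed.
End MeanSlopes.

(** * Tangents to the concave envelope of the mean values *)

Section Envelope.
Variable R : realType.
Implicit Types (E e : R -> R) (x d c th : R) (K : nat).

(** One-sided Fermat rule: E may exceed E s to the right of s. *)
Lemma left_max_slope_ge0 E e s : primitive E e -> 0 < s ->
  (forall x, 0 <= x <= s -> E x <= E s) -> 0 <= e s.
Proof.
move=> dE s0 Emax; rewrite leNgt; apply/negP => es.
have [g [hg cg gs]] := (is_derive1_caratheodory E s (e s)).1 (dE s).
rewrite -gs in es.
have /nbhs_ballP[r /= r0 hr] : \forall z \near s, g z < 0.
  exact: (cvgr_lt (g s) cg 0 es).
pose z := s - Num.min (r / 2) s.
have m0 : 0 < Num.min (r / 2) s by rewrite lt_min s0 divr_gt0.
have zs : 0 <= z <= s by rewrite /z subr_ge0 ge_min lexx orbT /= gerBl ltW.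
have gz : g z < 0.
  apply: hr; rewrite /ball /= /z opprB addrC subrK gtr0_norm//.
  by rewrite gt_min ltr_pdivrMr// ltr_pMr// ltr1n.
have := Emax _ zs; rewrite -subr_le0 hg leNgt => /negP; apply.
by rewrite nmulr_rgt0// /z addrAC subrr add0r oppr_lt0.
Qed.

(** The tangent at nu to the concave envelope of H.  For a slope a, compare the maxima
    of H x - a (x - nu) on the two sides of nu: for very negative a the right one is
    larger, for large a the left one, and they depend continuously on a. *)
Lemma chord_tangent (H : R -> R) nu : continuous H -> 0 < nu < 1 ->
  exists h a s t, [/\ 0 <= s <= nu, nu <= t <= 1,
    H s = h + a * (s - nu), H t = h + a * (t - nu) &
    forall x, 0 <= x <= 1 -> H x <= h + a * (x - nu)].
Proof.
move=> cH /andP[nu0 nu1].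
have cHa a : continuous (fun x => H x - a * (x - nu)).
  move=> x; apply: cvgB; first exact: cH.
  by apply: cvgM; [exact: cvg_cst|apply: cvgB; [exact: cvg_id|exact: cvg_cst]].
have maxl a : {s | 0 <= s <= nu & forall x, 0 <= x <= nu ->
    H x - a * (x - nu) <= H s - a * (s - nu)}.
  apply: cid2.
  have [s s01 hs] := EVT_max (ltW nu0) (continuous_subspaceT (cHa a)).
  by exists s; [|move=> x hx; apply: hs]; rewrite -?in_itv.
have maxr a : {t | nu <= t <= 1 & forall x, nu <= x <= 1 ->
    H x - a * (x - nu) <= H t - a * (t - nu)}.
  apply: cid2.
  have [s s01 hs] := EVT_max (ltW nu1) (continuous_subspaceT (cHa a)).
  by exists s; [|move=> x hx; apply: hs]; rewrite -?in_itv.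
pose sl a := s2val (maxl a); pose tr a := s2val (maxr a).
have sl_in a : 0 <= sl a <= nu by exact: (s2valP (maxl a)).
have tr_in a : nu <= tr a <= 1 by exact: (s2valP (maxr a)).
have sl_max a x : 0 <= x <= nu -> H x - a * (x - nu) <= H (sl a) - a * (sl a - nu).
  exact: (s2valP' (maxl a)).
have tr_max a x : nu <= x <= 1 -> H x - a * (x - nu) <= H (tr a) - a * (tr a - nu).
  exact: (s2valP' (maxr a)).
pose D a := (H (sl a) - a * (sl a - nu)) - (H (tr a) - a * (tr a - nu)).
have lip a b : D a - D b <= 2 * `|a - b|.
  have := sl_max b _ (sl_in a); have := tr_max a _ (tr_in b); rewrite /D.
  move: (sl_in a) (tr_in b) (H (sl a)) (H (tr a)) (H (sl b)) (H (tr b)).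
  move: (sl a) (tr a) (sl b) (tr b) => x1 x2 x3 x4 /andP[x10 x11] /andP[x40 x41] h1 h2 h3 h4 A B.
  have n0 : 0 <= `|a - b| by [].
  have := ler_norm (a - b); have := ler_norm (b - a); rewrite distrC => n1 n2.
  have c1 : (a - b) * (nu - x1) <= `|a - b| by nra.
  have c2 : (a - b) * (x4 - nu) <= `|a - b| by nra.
  by nra.
have cD : continuous D.
  move=> a; apply/cvgrPdist_lt => /= eps eps0; near=> b.
  have ab : `|a - b| < eps / 2.
    near: b.
    by exists (eps / 2) => //=; rewrite divr_gt0.
  rewrite ltr_norml; apply/andP; split.
    by have := lip b a; rewrite distrC; lra.
  by have := lip a b; lra.
have [m m01 hm] := EVT_max ler01 (continuous_subspaceT cH).
(* slopes beyond -B and C force one of the two maxima to be the larger *)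
pose B := (H m - H 1) / (1 - nu); pose C := (H m - H 0) / nu.
have hmax x : 0 <= x <= 1 -> H x <= H m by move=> ?; apply: hm; rewrite in_itv.
have B0 : 0 <= B by rewrite divr_ge0 ?subr_ge0 ?hmax ?lexx ?ler01// ltW.
have C0 : 0 <= C by rewrite divr_ge0 ?subr_ge0 ?hmax ?lexx ?ler01// ltW.
have DB : D (- B) <= 0.
  have hB : B * (1 - nu) = H m - H 1 by rewrite /B divfK// subr_eq0 gt_eqF.
  have := tr_max (- B) 1 _; rewrite lexx (ltW nu1) => /(_ isT).
  rewrite /D; have /andP[s1 s2] := sl_in (- B).
  have : H (sl (- B)) <= H m by apply: hmax; rewrite s1 (le_trans s2 (ltW nu1)).
  have : 0 <= B * (nu - sl (- B)) by rewrite mulr_ge0// subr_ge0.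
  by lra.
have DC : 0 <= D C.
  have hC : C * nu = H m - H 0 by rewrite /C divfK// gt_eqF.
  have := sl_max C 0 _; rewrite lexx (ltW nu0) => /(_ isT).
  rewrite /D; have /andP[s1 s2] := tr_in C.
  have : H (tr C) <= H m by apply: hmax; rewrite s2 (le_trans (ltW nu0) s1).
  have : 0 <= C * (tr C - nu) by rewrite mulr_ge0// subr_ge0.
  by lra.
have [||a _ Da] := @IVT R D (- B) C 0 _ (continuous_subspaceT cD).
- by lra.
- by rewrite ge_min DB le_max DC orbT.
exists (H (sl a) - a * (sl a - nu)), a, (sl a), (tr a); split => //; first by ring.
  by move/eqP: Da; rewrite subr_eq0 => /eqP ->; ring.
move=> x /andP[x0 x1]; have [xnu|xnu] := lerP x nu.
  by have := sl_max a x; rewrite x0 xnu => /(_ isT); lra.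
have := tr_max a x; rewrite x1 (ltW xnu) => /(_ isT).
by move: Da; rewrite /D; lra.
Unshelve. all: by end_near. Qed.

Lemma primitive_sub_quad G g h a nu : primitive G g ->
  primitive (fun x => G x - G 0 - h * x - a * (x * (x - nu)))
            (fun x => g x - h - a * (2 * x - nu)).
Proof.
move=> dG x.
have hid : is_derive x (1:R) (fun x : R => x) 1 by exact: is_derive_id.
have dl : is_derive x (1:R) (fun x : R => x - nu) 1.
  by have := is_deriveB hid (is_derive_cst nu x 1); rewrite subr0.
have dq : is_derive x (1:R) (fun x : R => x * (x - nu)) (2 * x - nu).
  by apply: is_derive_eq (is_deriveM hid dl) _; rewrite /GRing.scale /=; ring.
apply: is_derive_eq (is_deriveB (is_deriveB (is_deriveB (dG x) (is_derive_cst (G 0) x 1))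
  (is_deriveZ h hid)) (is_deriveZ a dq)) _.
by rewrite /GRing.scale /= subr0 mulr1.
Qed.

Lemma sum_sub_quad g (v : seq R) h a nu :
  \sum_(x <- v) (g x - h - a * (2 * x - nu)) =
  \sum_(x <- v) g x - (size v)%:R * h - a * (2 * \sum_(x <- v) x - (size v)%:R * nu).
Proof.
elim: v => [|x v IH]; first by rewrite !big_nil /=; ring.
by rewrite !big_cons IH /= -natr1; ring.
Qed.

(** Below, h bounds the mean of g under each law with the given mean c / K that is a
    mixture of uniform laws on intervals [0, x] with x in X: divided by x, the
    inequality for x bounds the mean of g over [0, x] by an affine function of x. *)
Lemma test_tuple G g K c (X : seq R) : primitive G g -> (2 <= K)%N ->
  1 <= c -> 2 * c <= K%:R -> {in X, forall x, 0 <= x <= 1} ->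
  exists v h a, [/\ size v = K, {in v, forall x, 0 <= x <= 1},
    \sum_(x <- v) x = c,
    {in X, forall x, G x - G 0 <= h * x + a * (x * (x - 2 * c / K%:R))} &
    K%:R * h <= \sum_(x <- v) g x].
Proof.
move=> dG K2 c1 cK X01.
have K0 : 0 < K%:R :> R by rewrite ltr0n ltnW.
set nu := 2 * c / K%:R.
have Knu : K%:R * nu = 2 * c by rewrite /nu mulrC divfK// gt_eqF.
have nu0 : 0 < nu by rewrite divr_gt0//; lra.
pose E h a x := G x - G 0 - h * x - a * (x * (x - nu)).
pose e h a x := g x - h - a * (2 * x - nu).
have dE h a : primitive (E h a) (e h a) by exact: primitive_sub_quad.
suff [v [h [a [sv v01 vc hX ev]]]] : exists v h a, [/\ size v = K,
    {in v, forall x, 0 <= x <= 1}, \sum_(x <- v) x = c,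
    {in X, forall x, E h a x <= 0} & 0 <= \sum_(x <- v) e h a x].
  exists v, h, a; split => // [x xX|].
    by have := hX x xX; rewrite /E; lra.
  by move: ev; rewrite sum_sub_quad sv vc Knu subrr mulr0 subr0 subr_ge0.
move: cK; rewrite le_eqVlt => /orP[/eqP cK|cK].
  (* The mean is 1/2, so that the tangent would be vertical at the end of [0, 1].
     Here X being finite matters: a steep enough slope a works at all its points. *)
  pose h := G 1 - G 0.
  pose a := - \sum_(x <- X) `|G x - G 0 - h * x| / (x * (1 - x)).
  have nu1 : nu = 1 by rewrite /nu cK divff// gt_eqF.
  have [|||||v [sv v01 vc ev]] := @symmetric_tuple R _ _ K 1 c 2^-1 (dE h a) K2.
  - by lra.
  - by rewrite ler01 lexx.
  - by apply/andP; split; lra.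
  - by rewrite /E nu1 mulfV// !subrr !(mul0r, mulr0) mulr1 !subrr.
  - by move=> ?; exfalso; lra.
  exists v, h, a; split => // x xX.
  rewrite /E nu1.
  have /andP[x0 x1] := X01 x xX.
  have [->|xn0] := eqVneq x 0; first by rewrite !(mul0r, mulr0, subrr).
  have [->|xn1] := eqVneq x 1; first by rewrite mulr1 !(subrr, mulr0).
  have xx : 0 < x * (1 - x).
    by rewrite mulr_gt0 ?subr_gt0 ?lt_neqAle ?x0 ?x1 ?andbT// eq_sym.
  have -> : a * (x * (x - 1)) = - a * (x * (1 - x)) by ring.
  rewrite subr_le0 (le_trans (ler_norm _))// -ler_pdivrMr// /a opprK.
  have nonneg : forall y, y \in X -> 0 <= `|G y - G 0 - h * y| / (y * (1 - y)).
    move=> y yX; have /andP[y0 y1] := X01 y yX.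
    by rewrite divr_ge0// mulr_ge0// subr_ge0.
  elim: (X) xX nonneg => // y s IH; rewrite inE big_cons => /orP[/eqP <-|xs] nn.
    by rewrite lerDl big_seq sumr_ge0// => z zs; apply: nn; rewrite inE zs orbT.
  rewrite (le_trans (IH xs _))//.
    by move=> z zs; apply: nn; rewrite inE zs orbT.
  by rewrite lerDr nn// inE eqxx.
have nu1 : nu < 1 by rewrite ltr_pdivrMr// mul1r.
(* H extends the mean of g over [0, x] continuously to x = 0 *)
have [H [hH cH H0]] := (is_derive1_caratheodory G 0 (g 0)).1 (dG 0).
have {}cH : continuous H.
  move=> x; have [->//|x0] := eqVneq x 0.
  have dGx : {for x, continuous (fun z => G z - G 0)}.
    apply: cvgB; last exact: cvg_cst.
    by have [dd _] := dG x; apply/differentiable_continuous; exact/derivable1_diffP.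
  have : {for x, continuous (fun z => (G z - G 0) / z)}.
    by apply: cvgM => //; apply: cvgV => //; exact: cvg_id.
  rewrite /continuous_at => cGx.
  have -> : H x = (G x - G 0) / x by rewrite hH subr0 mulfK.
  apply: cvg_trans cGx.
  apply: near_eq_cvg; near=> z; rewrite hH subr0 mulfK//.
  near: z; exact: (cvgr_neq0 x cvg_id x0).
have [|h [a [s [t [/andP[s0 snu] /andP[tnu t1] Hs Ht Hle]]]]] := chord_tangent cH (nu:=nu).
  by rewrite nu0.
have EH x : E h a x = x * (H x - (h + a * (x - nu))).
  by rewrite /E hH subr0; ring.
have Es : E h a s = 0 by rewrite EH Hs subrr mulr0.
have Et : E h a t = 0 by rewrite EH Ht subrr mulr0.
have Ele x : 0 <= x <= 1 -> E h a x <= 0.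
  by move=> x01; rewrite EH mulr_ge0_le0 ?subr_le0 ?Hle//; case/andP: x01.
have ege0 y : 0 < y <= 1 -> E h a y = 0 -> 0 <= e h a y.
  move=> /andP[y0 y1] Ey; apply: (left_max_slope_ge0 (dE h a) y0) => x /andP[x0 xy].
  by rewrite Ey Ele// x0 (le_trans xy y1).
have [||||v [sv v01 vc ev]] := @balanced_tuple R _ _ K s t c (dE h a) K2 Ele Es Et _ _ s0 _ _ t1 c1.
- have [s00|sn0] := eqVneq s 0.
    move: Hs; rewrite s00 H0 /e => ->; lra.
  by apply: ege0 => //; rewrite lt_neqAle eq_sym sn0 s0 (le_trans snu (ltW nu1)).
- by apply: ege0 => //; rewrite (lt_le_trans nu0 tnu).
- by rewrite -Knu ler_pM2l.
- by rewrite -Knu ler_pM2l.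
by exists v, h, a; split => // x /X01; exact: Ele.
Unshelve. all: by end_near. Qed.
End Envelope.

(** * Laws that are uniform on the cells of a grid *)

Section GridMean.
Variables (R : realType) (N : nat) (s : nat -> R).
Hypotheses (N0 : (0 < N)%N) (s0 : s 0%N = 0) (sN : s N = 1)
  (s_incr : forall i, (i < N)%N -> s i < s i.+1)
  (s_cvx : forall i, (i.+1 < N)%N -> s i.+1 - s i <= s i.+2 - s i.+1).

Let gap i := s i.+1 - s i.

Let gap_gt0 i : (i < N)%N -> 0 < gap i.
Proof. by move=> iN; rewrite subr_gt0 s_incr. Qed.

Lemma grid_le i j : (i <= j <= N)%N -> s i <= s j.
Proof.
move=> /andP[ij]; rewrite -(subnK ij); elim: (j - i)%N => // d IH h.
by rewrite (le_trans (IH (ltnW h)))// ltW// s_incr.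
Qed.

Lemma gap_le i j : (i <= j < N)%N -> gap i <= gap j.
Proof.
move=> /andP[ij]; rewrite -(subnK ij); elim: (j - i)%N => // d IH h.
by rewrite (le_trans (IH (ltnW h)))// s_cvx.
Qed.

Lemma grid01 i : (i <= N)%N -> 0 <= s i <= 1.
Proof. by move=> iN; rewrite -s0 -sN !grid_le// ?iN ?leqnn. Qed.

(** The mean of G^`() under the law that gives the mass 1/N to each cell
    [s i, s i.+1] and is uniform on each of them. *)
Definition grid_mean (G : R -> R) : R :=
  N%:R^-1 * \sum_(i < N) (G (s i.+1) - G (s i)) / gap i.

(** The mean of that law. *)
Definition grid_center : R := N%:R^-1 * \sum_(i < N) (s i + s i.+1) / 2.

(** Summation by parts: the densities 1 / gap i decrease, so the sum is a combination
    of the F i with nonnegative coefficients.  This is where the law is used as a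
    mixture of uniform laws on the intervals [0, s i]. *)
Lemma abel_grid (F : nat -> R) : F 0%N = 0 -> (forall i, (i <= N)%N -> F i <= 0) ->
  \sum_(i < N) (F i.+1 - F i) / gap i <= 0.
Proof.
move=> F0 Fle.
have step n : (n < N)%N -> \sum_(i < n.+1) (F i.+1 - F i) / gap i <= F n.+1 / gap n.
  elim: n => [|n IH] nN; first by rewrite big_ord_recr big_ord0 /= F0 add0r subr0.
  rewrite big_ord_recr /=.
  apply: (@le_trans _ _ (F n.+1 / gap n + (F n.+2 - F n.+1) / gap n.+1)).
    by rewrite lerD2r IH// ltnW.
  rewrite mulrBl addrCA -[leRHS]addr0 lerD2l subr_le0.
  rewrite -subr_ge0 -mulrBr -mulrNN opprB mulr_ge0 ?oppr_ge0 ?Fle// 1?ltnW//.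
  have g1 := gap_gt0 nN; have g0 := gap_gt0 (ltnW nN).
  by rewrite subr_ge0 lef_pV2 ?posrE//; apply: s_cvx.
have := step N.-1; rewrite prednK// => /(_ (leqnn _)) /le_trans; apply.
by rewrite mulr_le0_ge0 ?Fle// invr_ge0 ltW// gap_gt0// prednK.
Qed.

(** The quadratic term drops out because its derivative a (2 x - 2 grid_center)
    has mean zero. *)
Lemma grid_mean_le (G : R -> R) h a :
  (forall i, (i <= N)%N ->
     G (s i) - G 0 <= h * s i + a * (s i * (s i - 2 * grid_center))) ->
  grid_mean G <= h.
Proof.
move=> hG; set nu := 2 * grid_center in hG *.
pose F i := G (s i) - G 0 - h * s i - a * (s i * (s i - nu)).
have NN : N%:R != 0 :> R by rewrite pnatr_eq0 -lt0n.
have Fle i : (i <= N)%N -> F i <= 0 by move=> /hG; rewrite /F; lra.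
have F0 : F 0%N = 0 by rewrite /F s0 subrr !(mul0r, mulr0) !subr0.
have := abel_grid F0 Fle.
have -> : \sum_(i < N) (F i.+1 - F i) / gap i =
   \sum_(i < N) (G (s i.+1) - G (s i)) / gap i
   - \sum_(i < N) (h + a * (2 * ((s i + s i.+1) / 2) - nu)).
  rewrite -sumrB; apply: eq_bigr => i _.
  rewrite /F; have := gap_gt0 (ltn_ord i); rewrite /gap => /lt0r_neq0 g0.
  by field.
rewrite subr_le0 => le1; rewrite /grid_mean mulrC ler_pdivrMr ?ltr0n//.
apply: (le_trans le1).
rewrite big_split /= sumr_const card_ord -[h *+ N]mulr_natr -mulr_sumr sumrB -mulr_sumr.
rewrite sumr_const card_ord -[nu *+ N]mulr_natr.
suff -> : 2 * (\sum_(i < N) (s i + s i.+1) / 2) - nu * N%:R = 0 by rewrite mulr0 addr0.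
by rewrite /nu /grid_center; field.
Qed.

Lemma grid_test_tuple G g K : primitive G g -> (2 <= K)%N ->
  1 <= K%:R * grid_center -> 2 * grid_center <= 1 ->
  exists v, [/\ size v = K, {in v, forall x, 0 <= x <= 1},
    \sum_(x <- v) x = K%:R * grid_center & K%:R * grid_mean G <= \sum_(x <- v) g x].
Proof.
move=> dG K2 c1 c2.
have K0 : 0 < K%:R :> R by rewrite ltr0n ltnW.
have [||v [h [a [sv v01 vc hX hv]]]] :=
    @test_tuple R G g K _ [seq s i | i <- iota 0 N.+1] dG K2 c1.
- by rewrite mulrCA -[leRHS]mulr1 ler_pM2l.
- by move=> x /mapP[i]; rewrite mem_iota add0n ltnS => iN ->; exact: grid01.
exists v; split => //; apply: le_trans hv; rewrite ler_pM2l//.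
apply: (@grid_mean_le _ _ a) => i iN.
have -> : 2 * grid_center = 2 * (K%:R * grid_center) / K%:R.
  by field; rewrite gt_eqF.
by apply: hX; apply/mapP; exists i => //; rewrite mem_iota add0n ltnS.
Qed.
End GridMean.

(** * Approachability *)

Section Approachability.
Variables (R : realType) (I : finType) (T : Type) (y : T -> I -> R) (D : R).
Variable good : T -> Prop.
Hypothesis separated : forall lam : I -> R,
  exists2 v, good v & 0 <= \sum_i lam i * y v i.
Hypothesis bounded : forall v, good v -> \sum_i y v i ^+ 2 <= D.

(** Each new vector is chosen on the side of the origin opposite to the sum of the
    previous ones, so the squares add up as if the vectors were orthogonal.  Divided
    by n, the sum tends to 0: this is Blackwell's argument for a single point. *)
Lemma approachability n : exists vs : 'I_n -> T, (forall k, good (vs k)) /\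
  \sum_i (\sum_(k < n) y (vs k) i) ^+ 2 <= n%:R * D.
Proof.
elim: n => [|n [vs [gvs hvs]]].
  exists (fun k : 'I_0 => match notF (ltn_ord k) with end).
  split=> [[]//|]; rewrite mul0r big1// => i _; by rewrite big_ord0 expr0n.
pose S i := \sum_(k < n) y (vs k) i.
have [v gv hv] := separated (fun i => - S i).
exists (fun k => if unlift ord_max k is Some k' then vs k' else v); split.
  by move=> k; case: unliftP.
have Sn i : \sum_(k < n.+1) y (if unlift ord_max k is Some k' then vs k' else v) i
    = S i + y v i.
  rewrite big_ord_recr /= unlift_none; congr (_ + _); apply: eq_bigr => k _.
  have -> : widen_ord (leqnSn n) k = lift ord_max k.
    by apply: val_inj => /=; rewrite /bump leqNgt ltn_ord.
  by rewrite liftK.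
under eq_bigr do rewrite Sn sqrrD.
rewrite !big_split /= -natr1 mulrDl mul1r; apply: lerD; last exact: bounded.
rewrite -[leRHS]addr0; apply: lerD; first exact: hvs.
suff h : \sum_i S i * y v i <= 0 by rewrite -[leRHS]addr0 lerD.
by move: hv; under eq_bigr do rewrite mulNr; rewrite sumrN oppr_ge0.
Qed.
End Approachability.

(** * Arrays with constant row sums *)

Section BalancedArray.
Variable R : realType.

Lemma primitive_hinge (b : R) :
  primitive (fun x => - (Num.max (b - x) 0 ^+ 2 / 2)) (fun x => Num.max (b - x) 0).
Proof.
move=> x.
have did : is_derive x (1:R) (fun z : R => b - z) (- 1).
  have := is_deriveB (is_derive_cst b x 1) (is_derive_id x (1:R)).
  by rewrite sub0r.
have [xb|bx|->] := ltgtP x b.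
- apply: (@near_eq_is_derive _ _ _ (fun z : R => - ((b - z) ^+ 2 / 2))).
    near=> z; rewrite max_l// subr_ge0; apply/ltW; near: z.
    exact: (cvgr_lt x cvg_id b xb).
  rewrite max_l ?subr_ge0 ?ltW//.
  have := is_deriveN (is_deriveZ 2^-1 (is_deriveX 2 did)).
  rewrite (_ : - _ = fun z => - ((b - z) ^+ 2 / 2)); last first.
    by apply/funext => z /=; rewrite /GRing.scale /= mulrC.
  by move=> h; apply: is_derive_eq h _; rewrite /GRing.scale /= expr1; field.
- apply: (@near_eq_is_derive _ _ _ (cst 0)).
    near=> z; rewrite max_r ?expr0n /= ?mul0r ?oppr0// subr_le0; apply/ltW; near: z.
    exact: (cvgr_gt x cvg_id b bx).
  by rewrite max_r ?subr_le0 ?ltW//; exact: is_derive_cst.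
- apply/is_derive1_caratheodory; exists (fun z => Num.max (b - z) 0 / 2); split.
  + move=> z; rewrite subrr maxxx expr0n /= mul0r oppr0 subr0.
    by case: (lerP (b - z) 0) => _; [rewrite expr0n /= !mul0r oppr0|field].
  + apply: cvgM; last exact: cvg_cst.
    apply: (@continuous_comp _ _ _ (fun z => b - z) (fun z => Num.max z 0)).
      by apply: cvgB; [exact: cvg_cst|exact: cvg_id].
    apply: (@continuous_max _ _ id (cst 0)); [exact: cvg_id|exact: cvg_cst].
  + by rewrite subrr maxxx mul0r.
Unshelve. all: by end_near. Qed.

Lemma primitive_sum (I : finType) (lam : I -> R) (T t : I -> R -> R) :
  (forall i, primitive (T i) (t i)) ->
  primitive (fun x => \sum_i lam i * T i x) (fun x => \sum_i lam i * t i x).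
Proof.
move=> dT x; elim: (index_enum I) => [|i r IH].
  have -> : (fun z => \sum_(i <- [::]) lam i * T i z) = cst 0.
    by apply/funext => z; rewrite big_nil.
  by rewrite big_nil; exact: is_derive_cst.
have -> : (fun z => \sum_(i <- i :: r) lam i * T i z) =
    (fun z => lam i * T i z) + (fun z => \sum_(i <- r) lam i * T i z).
  by apply/funext => z; rewrite big_cons.
by rewrite big_cons; exact: (is_deriveD (is_deriveZ _ (dT i x)) IH).
Qed.

Variables (N : nat) (s : nat -> R).
Hypotheses (N0 : (0 < N)%N) (s0 : s 0%N = 0) (sN : s N = 1)
  (s_incr : forall i, (i < N)%N -> s i < s i.+1)
  (s_cvx : forall i, (i.+1 < N)%N -> s i.+1 - s i <= s i.+2 - s i.+1).

Let hinge j x : R := Num.max (s j - x) 0.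
Let Hinge j x : R := - (Num.max (s j - x) 0 ^+ 2 / 2).
Let z j := grid_mean N s (Hinge j).

Lemma grid_mean_hinge j : (j <= N)%N ->
  z j = N%:R^-1 * \sum_(i < j) (s j - (s i + s i.+1) / 2).
Proof.
move=> jN; rewrite /z /grid_mean; congr (_ * _).
rewrite (big_ord_widen N (fun i => s j - (s i + s i.+1) / 2) jN) [RHS]big_mkcond /=.
apply: eq_bigr => i _; rewrite /Hinge.
have gi : s i.+1 - s i != 0 by rewrite subr_eq0 gt_eqF// s_incr.
case: ltnP => ij.
  have h1 : s i <= s j by apply: (grid_le s_incr); rewrite (ltnW ij).
  have h2 : s i.+1 <= s j by apply: (grid_le s_incr); rewrite ij.
  by rewrite !max_l ?subr_ge0//; field.
have h1 : s j <= s i by apply: (grid_le s_incr); rewrite ij ltnW.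
have h2 : s j <= s i.+1 by apply: (grid_le s_incr); rewrite ltn_ord (leq_trans ij).
by rewrite !max_r ?subr_le0// subrr mul0r.
Qed.

Lemma grid_mean_hingeS j : (j < N)%N ->
  z j.+1 - z j = (s j.+1 - s j) * ((j%:R + 2^-1) / N%:R).
Proof.
move=> jN; rewrite (grid_mean_hinge jN) (grid_mean_hinge (ltnW jN)) -mulrBr big_ord_recr /=.
rewrite addrAC -sumrB.
under eq_bigr do rewrite opprB addrA subrK.
rewrite sumr_const card_ord -[_ *+ j]mulr_natr; field.
by rewrite pnatr_eq0 -lt0n.
Qed.

Lemma hinge_ge (j : nat) (x : R) : s j <= s j.+1 ->
  (x <= s j)%R%:R * (s j.+1 - s j) <= hinge j.+1 x - hinge j x.
Proof.
by move=> h; rewrite /hinge; have [xj|xj] := lerP x (s j); rewrite ?mul1r ?mul0r;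
  have [?|?] := lerP (s j - x) 0; have [?|?] := lerP (s j.+1 - x) 0; lra.
Qed.

Lemma hinge_le (j : nat) (x : R) : s j <= s j.+1 ->
  hinge j.+1 x - hinge j x <= (x < s j.+1)%R%:R * (s j.+1 - s j).
Proof.
by move=> h; rewrite /hinge; have [xj|xj] := ltrP x (s j.+1); rewrite ?mul1r ?mul0r;
  have [?|?] := lerP (s j - x) 0; have [?|?] := lerP (s j.+1 - x) 0; lra.
Qed.

(** Approachability for the test functions x |-> max (s j - x, 0).  The difference
    quotient of two consecutive ones lies between the indicators of x <= s j and of
    x < s j.+1, so their empirical means control the empirical distribution function
    of the entries at the points of the grid. *)
Lemma balanced_array K : (2 <= K)%N ->
  1 <= K%:R * grid_center N s -> 2 * grid_center N s <= 1 ->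
  exists n (vs : 'I_n -> seq R), [/\ (0 < n)%N,
    forall k, [/\ size (vs k) = K, {in vs k, forall x, 0 <= x <= 1} &
      \sum_(x <- vs k) x = K%:R * grid_center N s] &
    forall j, (j < N)%N ->
      (N * \sum_k count (fun x => (x <= s j)%R) (vs k) <= n * K * j.+1)%N /\
      (n * K * j <= N * \sum_k count (fun x => (x < s j.+1)%R) (vs k))%N].
Proof.
move=> K2 c1 c2.
pose good v := [/\ size v = K, {in v, forall x : R, 0 <= x <= 1} &
      \sum_(x <- v) x = K%:R * grid_center N s].
pose y v (j : 'I_N.+1) := \sum_(x <- v) hinge j x - K%:R * z j.
have K0 : 0 < K%:R :> R by rewrite ltr0n ltnW.
have N0' : 0 < N%:R :> R by rewrite ltr0n.
have sep (lam : 'I_N.+1 -> R) : exists2 v, good v & 0 <= \sum_j lam j * y v j.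
  have dG := primitive_sum lam (fun j : 'I_N.+1 => primitive_hinge (s j)).
  have [v [sv v01 vc hv]] := grid_test_tuple N0 s0 sN s_incr s_cvx dG K2 c1 c2.
  exists v; first by split.
  have -> : \sum_j lam j * y v j = \sum_(x <- v) (\sum_j lam j * hinge j x)
      - K%:R * \sum_j lam j * z j.
    rewrite exchange_big /= mulr_sumr -sumrB; apply: eq_bigr => j _.
    by rewrite -mulr_sumr /y; ring.
  rewrite subr_ge0; apply: le_trans hv; rewrite ler_pM2l// /grid_mean.
  rewrite le_eqVlt; apply/orP; left; apply/eqP.
  under eq_bigr do rewrite /z /grid_mean mulrCA mulr_sumr.
  rewrite -mulr_sumr exchange_big /=; congr (_ * _); apply: eq_bigr => i _.
  by rewrite -sumrB mulr_suml; apply: eq_bigr => j _; rewrite mulrA -mulrBr.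
pose D := \sum_(j < N.+1) (K%:R + `|K%:R * z j|) ^+ 2.
have bnd v : good v -> \sum_j y v j ^+ 2 <= D.
  move=> [sv v01 _]; apply: ler_sum => j _.
  rewrite -real_normK ?num_real// ler_pXn2r ?nnegrE ?addr_ge0//.
  rewrite (le_trans (ler_normB _ _))// lerD2r ger0_norm; last first.
    by rewrite sumr_ge0// => x _; rewrite /hinge le_max lexx orbT.
  rewrite -sv -sum1_size natr_sum [leLHS]big_seq [leRHS]big_seq; apply: ler_sum => x xv.
  have /andP[x0 x1] := v01 x xv; have /andP[_ sj1] := grid01 s0 sN s_incr (ltn_ord j : (j <= N)%N).
  by rewrite /hinge ge_max ler01 andbT; lra.
(* The first gap is the smallest.  With this precision the error in each difference
   quotient is at most 1 / (2 N), which turns (j + 1/2) / N into (j + 1) / N or j / N. *)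
pose eta := (s 1%N - s 0%N) / (4 * N%:R).
have g0 : 0 < s 1%N - s 0%N by rewrite subr_gt0 s_incr.
have eta0 : 0 < eta by rewrite divr_gt0// mulr_gt0.
have etaK : 0 < (eta * K%:R) ^+ 2 by rewrite exprn_gt0// mulr_gt0.
have D0 : 0 <= D by apply: sumr_ge0 => j _; exact: sqr_ge0.
pose n := (Num.truncn (D / (eta * K%:R) ^+ 2)).+1.
have n0 : 0 < n%:R :> R by rewrite ltr0n.
have nD : n%:R * D <= (eta * K%:R * n%:R) ^+ 2.
  rewrite [leRHS]exprMn expr2 mulrA mulrC ler_pM2r// -ler_pdivrMl// mulrC.
  by rewrite ltW// truncnS_gt.
have [vs [gvs hvs]] := approachability sep bnd n.
exists n, vs; split => // j jN.
have ybnd (i : 'I_N.+1) : `|\sum_(k < n) y (vs k) i| <= eta * K%:R * n%:R.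
  have e0 : 0 <= eta * K%:R * n%:R by rewrite !mulr_ge0// ltW.
  rewrite -(@ler_pXn2r _ 2) ?nnegrE// real_normK ?num_real//.
  apply: le_trans nD; apply: le_trans hvs.
  by rewrite (bigD1 i)//= lerDl sumr_ge0// => ? _; exact: sqr_ge0.
pose A (i : nat) := \sum_(k < n) \sum_(x <- vs k) hinge i x.
have hA (i : nat) : (i <= N)%N -> `|A i - n%:R * K%:R * z i| <= eta * K%:R * n%:R.
  move=> iN; have := ybnd (Ordinal (iN : (i < N.+1)%N)); rewrite /y /= sumrB.
  by rewrite sumr_const card_ord -[_ *+ n]mulr_natl mulrA.
have sj : s j <= s j.+1 by rewrite ltW ?s_incr.
have gj : 0 < s j.+1 - s j by rewrite subr_gt0 s_incr.
have etaj : 4 * N%:R * eta <= s j.+1 - s j.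
  rewrite /eta mulrC divfK ?gt_eqF ?mulr_gt0//.
  by apply: (gap_le s_cvx (i := 0)); rewrite jN.
have := grid_mean_hingeS jN; move/eqP; rewrite subr_eq => /eqP zS.
have := hA j (ltnW jN); have := hA j.+1 jN; rewrite zS !ler_norml.
set g := s j.+1 - s j in gj etaj *.
move=> /andP[hS1 hS2] /andP[h1 h2].
have nK0 : 0 < n%:R * K%:R :> R by rewrite mulr_gt0.
have eN : 2 * (n%:R * K%:R * eta) <= n%:R * K%:R * (g * (2^-1 / N%:R)).
  rewrite mulrCA ler_pM2l// [g * _]mulrA ler_pdivlMr//; lra.
have diff : A j.+1 - A j = \sum_(k < n) \sum_(x <- vs k) (hinge j.+1 x - hinge j x).
  by rewrite /A -sumrB; apply: eq_bigr => k _; rewrite sumrB.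
have cntE (p : pred R) : (\sum_(k < n) count p (vs k))%:R * g =
   \sum_(k < n) \sum_(x <- vs k) (p x)%:R * g :> R.
  rewrite natr_sum mulr_suml; apply: eq_bigr => k _.
  by rewrite -mulr_suml -sum1_count natr_sum big_mkcond /=; congr (_ * _);
    apply: eq_bigr => x _; case: (p x).
split.
- rewrite -(ler_nat R) natrM -(ler_pM2r gj) -mulrA cntE.
  apply: (@le_trans _ _ (N%:R * (A j.+1 - A j))).
    by rewrite ler_pM2l// diff; apply: ler_sum => k _; apply: ler_sum => x _; exact: hinge_ge.
  apply: (@le_trans _ _ (N%:R * (n%:R * K%:R * (g * (j.+1%:R / N%:R))))).
    rewrite ler_pM2l//.
    have -> : j.+1%:R / N%:R = (j%:R + 2^-1) / N%:R + 2^-1 / N%:R :> R.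
      by rewrite -natr1 -mulrDl; congr (_ / _); lra.
    by rewrite mulrDr [X in _ <= X]mulrDr; lra.
  rewrite !natrM le_eqVlt; apply/orP; left; apply/eqP; field.
  by rewrite gt_eqF.
- rewrite -(ler_nat R) [leRHS]natrM -(ler_pM2r gj) -[leRHS]mulrA cntE.
  apply: (@le_trans _ _ (N%:R * (A j.+1 - A j))); last first.
    by rewrite ler_pM2l// diff; apply: ler_sum => k _; apply: ler_sum => x _; exact: hinge_le.
  apply: (@le_trans _ _ (N%:R * (n%:R * K%:R * (g * (j%:R / N%:R))))).
    rewrite !natrM le_eqVlt; apply/orP; left; apply/eqP; field.
    by rewrite gt_eqF.
  rewrite ler_pM2l//.
  have -> : j%:R / N%:R = (j%:R + 2^-1) / N%:R - 2^-1 / N%:R :> R.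
    by rewrite -mulrBl; congr (_ / _); lra.
  by rewrite mulrBr [X in X <= _]mulrBr; lra.
Qed.
End BalancedArray.

(** * From arrays to permutations of cells *)

Section Ranks.
Variables (R : realType) (I : finType) (x : I -> R).

Lemma exists_rank : exists rk : I -> 'I_#|I|, [/\ bijective rk,
  forall a, (rk a < #|[pred b | (x b <= x a)%R]|)%N &
  forall a, (#|[pred b | (x b < x a)%R]| <= rk a)%N].
Proof.
pose le a b := (x a <= x b)%R; pose l := sort le (enum I).
have tot : total le by move=> a b; exact: le_total.
have tr : transitive le by move=> b a c; exact: le_trans.
have refl : reflexive le by move=> a; exact: lexx.
have lmem a : a \in l by rewrite mem_sort mem_enum.
have lu : uniq l by rewrite sort_uniq enum_uniq.
have lsz : size l = #|I| by rewrite size_sort -cardE.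
have srt : sorted le l by exact: sort_sorted.
have rkP a : (index a l < #|I|)%N by rewrite -lsz index_mem.
have cardl (p : pred I) : #|p| = count p l.
  rewrite cardE -size_filter; apply: perm_size; apply: uniq_perm.
  - exact: enum_uniq.
  - exact: filter_uniq.
  - by move=> a; rewrite mem_enum mem_filter lmem andbT.
exists (fun a => Ordinal (rkP a)); split.
- apply: inj_card_bij; last by rewrite card_ord.
  by move=> a b /(congr1 val) /= /index_inj; apply.
- move=> a /=; rewrite cardl -[l in count _ l](cat_take_drop (index a l).+1) count_cat.
  apply: leq_trans (leq_addr _ _).
  have : all [pred b | (x b <= x a)%R] (take (index a l).+1 l).
    apply/(all_nthP a) => i; rewrite size_takel ?lsz// => ilt.
    rewrite nth_take//= -[X in (_ <= x X)%R](nth_index a (lmem a)).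
    by apply: (sorted_leq_nth tr refl a srt); rewrite ?inE ?lsz// (leq_ltn_trans _ (rkP a)).
  by rewrite all_count => /eqP ->; rewrite size_takel// lsz.
- move=> a /=; rewrite cardl -[l in count _ l](cat_take_drop (index a l)) count_cat.
  have -> : count [pred b | (x b < x a)%R] (drop (index a l) l) = 0%N.
    apply/eqP; rewrite -leqn0 leqNgt -has_count; apply/negP => /(has_nthP a)[i].
    rewrite size_drop ltn_subRL lsz => ilt /=; rewrite nth_drop ltNge => /negP; apply.
    rewrite -[X in (x X <= _)%R](nth_index a (lmem a)).
    by apply: (sorted_leq_nth tr refl a srt); rewrite ?inE ?lsz ?leq_addr.
  by rewrite addn0 (leq_trans (count_size _ _))// size_takel// lsz ltnW.
Qed.
End Ranks.

Section LatinArray.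
Variables (R : realType) (q : R -> R) (N : nat).
Hypotheses (N0 : (0 < N)%N) (q0 : q 0 = 0) (q1 : q 1 = 1)
  (q_incr : forall x y, 0 <= x -> x < y -> y <= 1 -> q x < q y).
Let s i := q (i%:R / N%:R).
Hypothesis s_cvx : forall i, (i.+1 < N)%N -> s i.+1 - s i <= s i.+2 - s i.+1.

Let q_le x y : 0 <= x -> x <= y -> y <= 1 -> q x <= q y.
Proof.
move=> x0; rewrite le_eqVlt => /orP[/eqP -> //|xy] y1.
exact/ltW/q_incr.
Qed.

(** The cells of [0, 1] are matched with the entries of the array in increasing
    order, so q at either end of a cell is close to its entry.  Shifting a row
    cyclically makes every column run once through all entries. *)
Lemma latin_array K : (2 <= K)%N ->
  1 <= K%:R * grid_center N s -> 2 * grid_center N s <= 1 ->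
  let c := K%:R * grid_center N s in
  let w := K%:R * (2 * (1 - q (N.-1%:R / N%:R))) in
  exists m (pi : 'I_K -> 'I_m -> 'I_m), [/\ (0 < m)%N, forall k, injective (pi k) &
    forall i, \sum_k q ((pi k i).+1%:R / m%:R) <= c + w /\
              c - w <= \sum_k q ((pi k i)%:R / m%:R)].
Proof.
case: K => // K K2 c1 c2 c w.
have NR : 0 < N%:R :> R by rewrite ltr0n.
have s0 : s 0%N = 0 by rewrite /s mul0r.
have sN : s N = 1 by rewrite /s divff// gt_eqF.
have s_incr i : (i < N)%N -> s i < s i.+1.
  move=> iN; apply: q_incr; rewrite ?divr_ge0 ?ltr_pM2r ?invr_gt0 ?ltr_nat//.
  by rewrite ler_pdivrMr// mul1r ler_nat.
have [n [vs [n0 good cnt]]] := balanced_array N0 s0 sN s_incr s_cvx K2 c1 c2.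
pose I : finType := ('I_n * 'I_K.+1)%type.
pose x (a : I) := nth 0 (vs a.1) a.2.
have x01 a : 0 <= x a <= 1.
  by have [sv v01 _] := good a.1; apply: v01; rewrite mem_nth// sv.
have cI : #|I| = (n * K.+1)%N by rewrite card_prod !card_ord.
have cntE (p : pred R) : #|[pred b | p (x b)]| = \sum_k count p (vs k).
  rewrite -sum1_card (eq_bigl (fun b : I => true && p (nth 0 (vs b.1) b.2)))//.
  rewrite -(pair_big_dep xpredT (fun k (l : 'I_K.+1) => p (nth 0 (vs k) l)) (fun _ _ => 1%N)) /=.
  apply: eq_bigr => k _; rewrite -sum1_count [RHS](big_nth 0) big_mkord.
  by have [-> _ _] := good k.
have [rk [bij rk_hi rk_lo]] := exists_rank x.
have m0 : (0 < #|I|)%N by rewrite cI muln_gt0 n0.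
have mR : 0 < #|I|%:R :> R by rewrite ltr0n.
pose om := 2 * (1 - q (N.-1%:R / N%:R)).
have gapN i : (i < N)%N -> s i.+1 - s i <= om / 2.
  move=> iN; rewrite /om mulrC mulKf//.
  have -> : 1 - q (N.-1%:R / N%:R) = s N.-1.+1 - s N.-1 by rewrite prednK// sN.
  by apply: (gap_le s_cvx); rewrite -ltnS prednK// iN leqnn.
have om0 : 0 <= om.
  by have := gapN 0%N N0; have := s_incr 0%N N0; lra.
(* q varies by at most om over two consecutive cells of the grid *)
have cell a : exists2 j, (j < N)%N & s j <= x a <= s j.+1.
  have /andP[xa0 xa1] := x01 a.
  have ex : exists j, (x a <= s j)%R && (j <= N)%N by exists N; rewrite sN xa1 leqnn.
  case: (ex_minnP ex) => -[|j] /andP[xj jN] jmin.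
    exists 0%N => //; rewrite s0 xa0 (le_trans xj)// s0.
    by have := s_incr 0%N N0; rewrite s0 => /ltW.
  exists j => //; rewrite xj andbT leNgt; apply/negP => xs.
  by have := jmin j; rewrite (ltW xs) (ltnW jN) ltnn => /(_ isT).
have hi a : q ((rk a).+1%:R / #|I|%:R) <= x a + om.
  have [j jN /andP[sj xj]] := cell a.
  have [j1N|j1N] := ltnP j.+1 N; last first.
    have jN1 : j.+1 = N by apply/eqP; rewrite eqn_leq jN.
    apply: (@le_trans _ _ (q 1)).
      apply: q_le; rewrite ?divr_ge0//.
      by rewrite ler_pdivrMr// mul1r ler_nat.
    have sj1 : s j.+1 = 1 by rewrite jN1 sN.
    by have := gapN j jN; rewrite q1; lra.
  apply: (@le_trans _ _ (s j.+2)); last first.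
    by have := gapN j jN; have := gapN j.+1 j1N; lra.
  apply: q_le; rewrite ?divr_ge0//; last by rewrite ler_pdivrMr// mul1r ler_nat.
  rewrite ler_pdivrMr// mulrAC ler_pdivlMr// -!natrM ler_nat.
  have [h _] := cnt j.+1 j1N; rewrite mulnC (leq_trans _ (leq_trans h _))//; last first.
    by rewrite cI mulnC.
  rewrite leq_mul2l -cntE (leq_trans (rk_hi a)) ?orbT//.
  by apply: subset_leq_card; apply/fintype.subsetP => b; rewrite !inE => /le_trans; apply.
have lo a : x a - om <= q ((rk a)%:R / #|I|%:R).
  have [j jN /andP[sj xj]] := cell a.
  case: j jN sj xj => [|j] jN sj xj.
    apply: (@le_trans _ _ 0); first by have := gapN 0%N N0; rewrite s0 subr0; lra.
    rewrite -[X in X <= _]q0; apply: q_le; rewrite ?divr_ge0//.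
    by rewrite ler_pdivrMr// mul1r ler_nat ltnW.
  apply: (@le_trans _ _ (s j)).
    by have := gapN j (ltnW jN); have := gapN j.+1 jN; lra.
  apply: q_le; rewrite ?divr_ge0//; last by rewrite ler_pdivrMr// mul1r ler_nat ltnW.
  rewrite ler_pdivlMr// mulrAC ler_pdivrMr// -!natrM ler_nat.
  have [_ h] := cnt j (ltnW jN); rewrite -cI in h; rewrite mulnC (leq_trans h)// mulnC leq_mul2r.
  rewrite -cntE (leq_trans _ (rk_lo a)) ?orbT//.
  by apply: subset_leq_card; apply/fintype.subsetP => b; rewrite !inE => /lt_le_trans; apply.
have [un rkK unK] := bij.
pose shift (k : 'I_K.+1) (a : I) : I := (a.1, a.2 + k).
have rowsum (a : I) : \sum_k x (shift k a) = c.
  have [sv _ vc] := good a.1; rewrite /c -vc [RHS](big_nth 0) big_mkord sv.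
  rewrite [RHS](reindex_inj (@addrI _ a.2)) /=.
  by apply: eq_bigr => k _.
exists #|I|, (fun k i => rk (shift k (un i))); split => //.
  move=> k i j /(bij_inj bij) /eqP; rewrite /shift xpair_eqE => /andP[/eqP h1 /eqP /addIr h2].
  by apply: (can_inj unK); apply/eqP; rewrite -pair_eqE /pair_eq h1 h2 !eqxx.
have wE : w = \sum_(k < K.+1) om by rewrite sumr_const card_ord /w mulr_natl.
move=> i; rewrite -(rowsum (un i)) wE; split.
  by rewrite -big_split /=; apply: ler_sum => k _; exact: hi.
by rewrite -sumrB /=; apply: ler_sum => k _; exact: lo.
Qed.
End LatinArray.

(** * Powers have the required quantile functions *)

Section PowerQuantiles.
Variable R : realType.
Implicit Types a b r t x y : R.

(** Young's inequality applied to t and 1. *)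
Lemma bernoulli_powR r t : 1 <= r -> 0 <= t -> 1 + r * (t - 1) <= t `^ r.
Proof.
rewrite le_eqVlt => /orP[/eqP <- t0|r1 t0]; first by rewrite powRr1//; lra.
have r0 : 0 < r by lra.
have q0 : 0 < r / (r - 1) by rewrite divr_gt0// subr_gt0.
have := @conjugate_powR R t 1 r (r / (r - 1)) t0 ler01 r0 q0.
rewrite invf_div -{1}[r^-1]mul1r -mulrDl subrKC mulfV ?gt_eqF// => /(_ erefl).
rewrite mulr1 powR1 mul1r -mulrDl ler_pdivlMr//; lra.
Qed.

Lemma bernoulli_powR_concave r t : 0 < r <= 1 -> 0 <= t -> t `^ r <= 1 + r * (t - 1).
Proof.
move=> /andP[r0 r1] t0.
have := @bernoulli_powR r^-1 (t `^ r) _ (powR_ge0 _ _).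
rewrite invf_ge1// -powRrM mulfV ?gt_eqF// powRr1// => /(_ r1).
by rewrite -(ler_pM2l r0) mulrDr mulrA mulfV ?gt_eqF// mul1r mulr1; lra.
Qed.

Lemma tangent_powR_scale r x y : 0 <= x -> 0 < y ->
  x `^ r = y `^ r * (x / y) `^ r /\
  y `^ r + r * y `^ (r - 1) * (x - y) = y `^ r * (1 + r * (x / y - 1)).
Proof.
move=> x0 y0; have y0' := ltW y0; split.
  by rewrite -powRM ?divr_ge0// mulrC divfK// gt_eqF.
rewrite powRB; last by rewrite (lt0r_neq0 y0) implybT.
rewrite powRr1//.
by field; rewrite gt_eqF.
Qed.

Lemma tangent_powR r x y : 1 <= r -> 0 <= x -> 0 < y ->
  y `^ r + r * y `^ (r - 1) * (x - y) <= x `^ r.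
Proof.
move=> r1 x0 y0; have [-> ->] := tangent_powR_scale r x0 y0.
by rewrite ler_wpM2l ?powR_ge0// bernoulli_powR// divr_ge0// ltW.
Qed.

Lemma tangent_powR_concave r x y : 0 < r <= 1 -> 0 <= x -> 0 < y ->
  x `^ r <= y `^ r + r * y `^ (r - 1) * (x - y).
Proof.
move=> r1 x0 y0; have [-> ->] := tangent_powR_scale r x0 y0.
by rewrite ler_wpM2l ?powR_ge0// bernoulli_powR_concave// divr_ge0// ltW.
Qed.

(** The right-hand side contains the error at a of the tangent at x, whose sign is
    that of r - 1 for positive r. *)
Lemma trapezoid_excess r a b : 0 < a -> a < b -> exists2 x, a < x &
  (r + 1) / 2 * ((b - a) * (a `^ r + b `^ r)) - (b `^ (r + 1) - a `^ (r + 1)) =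
  (r + 1) / 2 * (a `^ r - (x `^ r + r * x `^ (r - 1) * (a - x))) * (b - a).
Proof.
move=> a0 ab.
pose f x := (r + 1) / 2 * ((x - a) * (a `^ r + x `^ r)) - x `^ (r + 1).
pose df x := (r + 1) / 2 * (a `^ r - (x `^ r + r * x `^ (r - 1) * (a - x))).
have der x : 0 < x -> is_derive x (1 : R) f (df x).
  move=> x0.
  have d1 : is_derive x (1 : R) (fun x => x - a) 1.
    by have := is_deriveB (is_derive_id x (1 : R)) (is_derive_cst a x 1); rewrite subr0.
  have d2 : is_derive x (1 : R) (fun x => a `^ r + x `^ r) (r * x `^ (r - 1)).
    have := is_deriveD (is_derive_cst (a `^ r) x 1) (is_derive1_powR r x0).
    by rewrite add0r.
  apply: is_derive_eq (is_deriveB (is_deriveZ ((r + 1) / 2) (is_deriveM d1 d2))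
    (is_derive1_powR (r + 1) x0)) _.
  rewrite /df /GRing.scale /= addrK; lra.
have der_in x : x \in `]a, b[ -> is_derive x (1 : R) f (df x).
  by rewrite in_itv /= => /andP[/(lt_trans a0) x0 _]; exact: der.
have cf : {within `[a, b], continuous f}.
  apply: derivable_within_continuous => x; rewrite in_itv /= => /andP[/(lt_le_trans a0) x0 _].
  by have [] := der x x0.
have [x xab h] := MVT ab der_in cf.
exists x; first by move: xab; rewrite in_itv /= => /andP[].
by rewrite -/(df x) -h /f; ring.
Qed.

Lemma trapezoid_powR r a b : 1 <= r -> 0 <= a -> a < b ->
  (b `^ (r + 1) - a `^ (r + 1)) / (r + 1) <= (b - a) * ((a `^ r + b `^ r) / 2).
Proof.
move=> r1 a0 ab; have rp : 0 < r + 1 by lra.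
rewrite ler_pdivrMr//.
suff : 0 <= (r + 1) / 2 * ((b - a) * (a `^ r + b `^ r)) - (b `^ (r + 1) - a `^ (r + 1)) by lra.
move: a0; rewrite le_eqVlt => /orP[/eqP a0|a0].
  rewrite -a0 !powR0 ?gt_eqF//; last by lra.
  have b0 : 0 < b by rewrite a0.
  rewrite powRD; last by rewrite (lt0r_neq0 b0) implybT.
  rewrite powRr1 ?(ltW b0)//.
  have : 0 <= (r - 1) * (b * b `^ r) by rewrite mulr_ge0 ?subr_ge0// mulr_ge0 ?powR_ge0// ltW.
  by lra.
have [x ax ->] := trapezoid_excess r a0 ab.
have x0 : 0 < x by apply: lt_trans ax.
rewrite mulr_ge0 ?subr_ge0 ?(ltW ab)// mulr_ge0 ?divr_ge0 ?(ltW rp)//.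
by rewrite subr_ge0 tangent_powR// ltW.
Qed.

Lemma trapezoid_powR_concave r a b : 0 < r <= 1 -> 0 <= a -> a < b ->
  (b - a) * ((a `^ r + b `^ r) / 2) <= (b `^ (r + 1) - a `^ (r + 1)) / (r + 1).
Proof.
move=> /andP[r0 r1] a0 ab; have rp : 0 < r + 1 by lra.
rewrite ler_pdivlMr//.
suff : (r + 1) / 2 * ((b - a) * (a `^ r + b `^ r)) - (b `^ (r + 1) - a `^ (r + 1)) <= 0 by lra.
move: a0; rewrite le_eqVlt => /orP[/eqP a0|a0].
  rewrite -a0 !powR0 ?gt_eqF//.
  have b0 : 0 < b by rewrite a0.
  rewrite powRD; last by rewrite (lt0r_neq0 b0) implybT.
  rewrite powRr1 ?(ltW b0)//.
  have : 0 <= (1 - r) * (b * b `^ r) by rewrite mulr_ge0 ?subr_ge0// mulr_ge0 ?powR_ge0// ltW.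
  by lra.
have [x ax ->] := trapezoid_excess r a0 ab.
have x0 : 0 < x by apply: lt_trans ax.
rewrite mulr_le0_ge0 ?subr_ge0 ?(ltW ab)// mulr_ge0_le0 ?divr_ge0 ?(ltW rp)//.
by rewrite subr_le0 tangent_powR_concave// ?r0// ltW.
Qed.

(** A grid below the diagonal has its center below 1/2. *)
Lemma grid_center_le_half N (s : nat -> R) : (0 < N)%N ->
  (forall i, (i <= N)%N -> s i <= i%:R / N%:R) -> 2 * grid_center N s <= 1.
Proof.
move=> N0 hs; have NR : 0 < N%:R :> R by rewrite ltr0n.
have odd_sum n : \sum_(i < n) (i%:R + i.+1%:R) = n%:R * n%:R :> R.
  elim: n => [|n IH]; first by rewrite big_ord0 mul0r.
  by rewrite big_ord_recr /= IH -natr1; ring.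
rewrite /grid_center mulrCA mulrC ler_pdivrMr// mul1r -mulr_suml mulrC divfK//.
apply: (@le_trans _ _ (\sum_(i < N) (i%:R + i.+1%:R) / N%:R)).
  by apply: ler_sum => i _; rewrite mulrDl lerD ?hs// ltnW.
by rewrite -mulr_suml odd_sum mulfK// gt_eqF.
Qed.

Lemma telescope_grid_powR N r : (0 < N)%N ->  0 < r ->
  \sum_(i < N) ((i.+1%:R / N%:R) `^ r - (i%:R / N%:R) `^ r) = 1 :> R.
Proof.
move=> N0 r0; have NR : 0 < N%:R :> R by rewrite ltr0n.
rewrite -(big_mkord xpredT (fun i => (i.+1%:R / N%:R) `^ r - (i%:R / N%:R) `^ r)).
rewrite telescope_sumr// mul0r powR0 ?gt_eqF// subr0 divff ?gt_eqF//.
by rewrite powR1.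
Qed.

Lemma exists_fine_grid (x : R) : exists2 N, (0 < N)%N & x <= N%:R.
Proof. by exists (Num.truncn x).+1 => //; rewrite ltW// truncnS_gt. Qed.

(** The quantile function x^r is convex, and the trapezoidal rule overestimates its
    integral 1/(r+1), which is at least 1/K because r <= K - 1. *)
Lemma latin_array_convex r K dl : (2 <= K)%N -> 1 <= r <= K%:R - 1 -> 0 < dl ->
  exists m (pi : 'I_K -> 'I_m -> 'I_m), [/\ (0 < m)%N, forall k, injective (pi k) &
    forall i, \sum_k ((pi k i).+1%:R / m%:R) `^ r <= K%:R / (r + 1) + dl].
Proof.
move=> K2 /andP[r1 rK] dl0; have r0 : 0 < r by lra.
have rp : 0 < r + 1 by lra.
have K0 : 0 < K%:R :> R by rewrite ltr0n ltnW.
have [N N0 hN] := exists_fine_grid (K%:R * (2^-1 + 2 * r) / dl).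
have NR : 0 < N%:R :> R by rewrite ltr0n.
pose q x : R := x `^ r; pose s i := q (i%:R / N%:R).
have x0 i : 0 <= i%:R / N%:R :> R by rewrite divr_ge0.
have stepN i : i.+1%:R / N%:R - i%:R / N%:R = N%:R^-1 :> R.
  by rewrite -natr1 mulrDl mul1r addrAC subrr add0r.
have step_lt i : i%:R / N%:R < i.+1%:R / N%:R :> R.
  by rewrite -subr_gt0 stepN invr_gt0.
have cvx i : (i.+1 < N)%N -> s i.+1 - s i <= s i.+2 - s i.+1.
  move=> iN; have y0 := le_lt_trans (x0 i) (step_lt i).
  have := tangent_powR r1 (x0 i) y0; have := tangent_powR r1 (x0 i.+2) y0.
  rewrite stepN -[i%:R / _ - _]opprB stepN /s /q; lra.
have ctr_ge : (r + 1)^-1 <= grid_center N s.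
  rewrite /grid_center -[leLHS]mulr1 -[X in _ * X <= _](telescope_grid_powR N0 rp) mulr_sumr mulr_sumr.
  apply: ler_sum => i _; rewrite mulrC.
  by have := trapezoid_powR r1 (x0 i) (step_lt i); rewrite stepN.
have ctr_le : grid_center N s <= (r + 1)^-1 + (2 * N%:R)^-1.
  have -> : grid_center N s = N%:R^-1 * \sum_(i < N) s i + (2 * N%:R)^-1.
    rewrite /grid_center -mulr_suml big_split /=.
    have -> : \sum_(i < N) s i.+1 = \sum_(i < N) s i + 1.
      apply/eqP; rewrite addrC -subr_eq -sumrB; apply/eqP.
      exact: telescope_grid_powR.
    by rewrite invfM; field; rewrite gt_eqF.
  rewrite lerD2r -[leRHS]mulr1 -[X in _ <= _ * X](telescope_grid_powR N0 rp) mulr_sumr mulr_sumr.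
  apply: ler_sum => i _; rewrite [leRHS]mulrC ler_pdivlMr// /s /q.
  have := x0 i; rewrite le_eqVlt => /orP[/eqP <-|xi].
    by rewrite (powR0 (lt0r_neq0 r0)) mulr0 mul0r (powR0 (lt0r_neq0 rp)) subr0 powR_ge0.
  have r11 : 1 <= r + 1 by lra.
  have := tangent_powR r11 (x0 i.+1) xi; rewrite addrK stepN; lra.
have c1 : 1 <= K%:R * grid_center N s.
  apply: le_trans (_ : K%:R * (r + 1)^-1 <= _); last by rewrite ler_pM2l.
  by rewrite ler_pdivlMr// mul1r; lra.
have c2 : 2 * grid_center N s <= 1.
  apply: grid_center_le_half => // i iN; rewrite /s /q.
  case: i iN => [|i] iN; first by rewrite mul0r powR0 ?gt_eqF.
  by rewrite ge1r_powR// divr_gt0//= ler_pdivrMr// mul1r ler_nat.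
have q0 : q 0 = 0 by rewrite /q powR0 ?gt_eqF.
have q1 : q 1 = 1 by rewrite /q powR1.
have qi x y : 0 <= x -> x < y -> y <= 1 -> q x < q y.
  move=> xx xy y1; rewrite /q gt0_ltr_powR// ?nnegrE//.
  by rewrite (le_trans xx)// ltW.
have [m [pi [m0 inj hpi]]] := latin_array N0 q0 q1 qi cvx K2 c1 c2.
exists m, pi; split => // i; have [h _] := hpi i; apply: (le_trans h).
have w : 1 - q (N.-1%:R / N%:R) <= r / N%:R.
  have -> : N.-1%:R / N%:R = 1 - N%:R^-1 :> R.
    by rewrite -subn1 natrB// mulrBl divff ?gt_eqF// mul1r.
  have := @bernoulli_powR r (1 - N%:R^-1) r1; rewrite /q.
  have : N%:R^-1 <= 1 :> R by rewrite invf_le1// ler1n.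
  by rewrite subr_ge0 => h1 /(_ h1); lra.
have := hN; rewrite ler_pdivrMr// => hN'.
have dlN : K%:R * (2^-1 + 2 * r) / N%:R <= dl by rewrite ler_pdivrMr// [leRHS]mulrC.
apply: (@le_trans _ _ (K%:R * ((r + 1)^-1 + (2 * N%:R)^-1) + K%:R * (2 * (r / N%:R)))).
  by apply: lerD; rewrite ler_pM2l//; rewrite ler_pM2l.
apply: le_trans (_ : K%:R / (r + 1) + K%:R * (2^-1 + 2 * r) / N%:R <= _); last by rewrite lerD2l.
by rewrite invfM; lra.
Qed.

(** Here the law of 1 - W^r is mixed, with the convex quantile function
    1 - (1 - x)^r and a mean r/(r+1) that is at least 1/K because r >= 1/(K-1).  The
    lower bound on its sums becomes an upper bound on the sums of powers once the
    cells are numbered backwards. *)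
Lemma latin_array_concave r K dl : (2 <= K)%N -> (K%:R - 1)^-1 <= r <= 1 -> 0 < dl ->
  exists m (pi : 'I_K -> 'I_m -> 'I_m), [/\ (0 < m)%N, forall k, injective (pi k) &
    forall i, \sum_k ((pi k i).+1%:R / m%:R) `^ r <= K%:R / (r + 1) + dl].
Proof.
move=> K2 /andP[rK r1] dl0.
have K1 : 0 < K%:R - 1 :> R by rewrite subr_gt0 ltr1n.
have r0 : 0 < r by apply: lt_le_trans rK; rewrite invr_gt0.
have r01 : 0 < r <= 1 by rewrite r0.
have rp : 0 < r + 1 by lra.
have K0 : 0 < K%:R :> R by rewrite ltr0n ltnW.
have rK1 : 1 <= r * (K%:R - 1) by rewrite -ler_pdivrMr// mul1r.
pose y := (dl / (2 * K%:R)) `^ r^-1.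
have y0 : 0 < y by rewrite powR_gt0// divr_gt0// mulr_gt0.
have [N N0 hN] := exists_fine_grid y^-1.
have NR : 0 < N%:R :> R by rewrite ltr0n.
have Ny : N%:R^-1 <= y by rewrite -[leRHS]invrK lef_pV2 ?posrE ?invr_gt0.
pose q x : R := 1 - (1 - x) `^ r; pose s i := q (i%:R / N%:R).
have u0 i : (i <= N)%N -> 0 <= 1 - i%:R / N%:R :> R.
  by move=> iN; rewrite subr_ge0 ler_pdivrMr// mul1r ler_nat.
have stepN i : (1 - i%:R / N%:R) - (1 - i.+1%:R / N%:R) = N%:R^-1 :> R.
  by rewrite -natr1 mulrDl; ring.
have step_lt i : 1 - i.+1%:R / N%:R < 1 - i%:R / N%:R :> R.
  by rewrite -subr_gt0 stepN invr_gt0.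
have cvx i : (i.+1 < N)%N -> s i.+1 - s i <= s i.+2 - s i.+1.
  move=> iN; have v0 := le_lt_trans (u0 _ iN) (step_lt i.+1).
  have := tangent_powR_concave r01 (u0 _ (ltnW (ltnW iN))) v0.
  have := tangent_powR_concave r01 (u0 _ iN) v0.
  have := stepN i.+1; rewrite -opprB => /eqP; rewrite eqr_oppLR => /eqP ->.
  rewrite stepN /s /q; lra.
have ctr_ge : r / (r + 1) <= grid_center N s.
  have -> : r / (r + 1) = N%:R^-1 * \sum_(i < N) 1 - (r + 1)^-1.
    rewrite sumr_const card_ord -[1 *+ N]mulr_natl mulr1 mulVf ?gt_eqF//.
    by field; rewrite gt_eqF.
  rewrite lerBlDl -lerBlDr /grid_center -mulrBr -sumrB.
  have tele : \sum_(i < N) ((1 - i%:R / N%:R) `^ (r + 1) - (1 - i.+1%:R / N%:R) `^ (r + 1)) = 1 :> R.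
    rewrite -(big_mkord xpredT (fun i => (1 - i%:R / N%:R) `^ (r + 1) - (1 - i.+1%:R / N%:R) `^ (r + 1))).
    under eq_bigr do rewrite -opprB.
    rewrite sumrN telescope_sumr// mul0r divff ?gt_eqF// subrr subr0 powR1.
    by rewrite powR0 ?gt_eqF// sub0r opprK.
  rewrite -[leRHS]mulr1 -[X in _ <= _ * X]tele !mulr_sumr.
  apply: ler_sum => i _; have := trapezoid_powR_concave r01 (u0 _ (ltn_ord i)) (step_lt i).
  rewrite stepN [X in _ <= X -> _]mulrC; apply: le_trans.
  by rewrite /s /q ler_pM2l ?invr_gt0//; lra.
have c1 : 1 <= K%:R * grid_center N s.
  apply: le_trans (_ : K%:R * (r / (r + 1)) <= _); last by rewrite ler_pM2l.
  by rewrite mulrA ler_pdivlMr// mul1r; lra.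
have c2 : 2 * grid_center N s <= 1.
  apply: grid_center_le_half => // i iN; rewrite /s /q.
  have [->|iN'] := eqVneq i N.
    by rewrite divff ?gt_eqF// subrr powR0 ?gt_eqF// subr0.
  have : 1 - i%:R / N%:R <= (1 - i%:R / N%:R) `^ r :> R.
    rewrite ger1_powR// subr_gt0 ltr_pdivrMr// mul1r ltr_nat ltn_neqAle iN' iN /=.
    by rewrite gerBl divr_ge0.
  by lra.
have q0 : q 0 = 0 by rewrite /q subr0 powR1 subrr.
have q1 : q 1 = 1 by rewrite /q subrr powR0 ?gt_eqF// subr0.
have qi x z : 0 <= x -> x < z -> z <= 1 -> q x < q z.
  move=> xx xz z1; rewrite /q ltrD2l ltrN2.
  have [? ? ?] : [/\ 0 <= 1 - z, 0 <= 1 - x & 1 - z < 1 - x] by split; lra.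
  by rewrite gt0_ltr_powR// nnegrE.
have [m [pi [m0 inj hpi]]] := latin_array N0 q0 q1 qi cvx K2 c1 c2.
have mR : 0 < m%:R :> R by rewrite ltr0n.
exists m, (fun k i => rev_ord (pi k i)); split => //.
  by move=> k; apply: inj_comp (inj k); exact: rev_ord_inj.
move=> i; have [_ h] := hpi i.
have w : K%:R * (2 * (1 - q (N.-1%:R / N%:R))) <= dl.
  rewrite /q.
  have -> : 1 - N.-1%:R / N%:R = N%:R^-1 :> R.
    by rewrite -subn1 natrB// mulrBl divff ?gt_eqF// mul1r opprB addrC subrK.
  rewrite opprB addrC subrK.
  have : (N%:R^-1) `^ r <= dl / (2 * K%:R).
    apply: (@le_trans _ _ (y `^ r)).
      by rewrite ge0_ler_powR// ?ltW// nnegrE ltW// invr_gt0.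
    by rewrite /y -powRrM mulVf ?gt_eqF// powRr1// ltW// divr_gt0// mulr_gt0.
  by rewrite ler_pdivlMr ?mulr_gt0//; lra.
have -> : \sum_k ((rev_ord (pi k i)).+1%:R / m%:R) `^ r = K%:R - \sum_k q ((pi k i)%:R / m%:R).
  rewrite /q sumrB sumr_const card_ord opprB addrC subrK; apply: eq_bigr => k _.
  congr (_ `^ _) => /=; rewrite subnSK// natrB 1?ltnW// mulrBl divff//.
  exact: lt0r_neq0.
have e : K%:R / (r + 1) = K%:R - K%:R * (r / (r + 1)) :> R by field; rewrite gt_eqF.
have : K%:R * (r / (r + 1)) <= K%:R * grid_center N s by rewrite ler_pM2l.
by rewrite e; move: h w; lra.
Qed.

Lemma latin_power_array r K dl : (2 <= K)%N -> (K%:R - 1)^-1 <= r <= K%:R - 1 -> 0 < dl ->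
  exists m (pi : 'I_K -> 'I_m -> 'I_m), [/\ (0 < m)%N, forall k, injective (pi k) &
    forall i, \sum_k ((pi k i).+1%:R / m%:R) `^ r <= K%:R / (r + 1) + dl].
Proof.
move=> K2 /andP[rK1 rK2]; have [r1|r1] := lerP 1 r.
  by apply: latin_array_convex => //; rewrite r1.
by apply: latin_array_concave => //; rewrite rK1 ltW.
Qed.
End PowerQuantiles.

(** * Uniform variables on atomless spaces *)

Section Sierpinski.
Context d (T : measurableType d) (R : realType) (P : probability T R).
Hypothesis P_atomless : atomless P.
Implicit Types A B C : set T.

Let mu A : R := fine (P A).

Let muE A : measurable A -> P A = (mu A)%:E.
Proof. by move=> mA; rewrite /mu fineK// fin_num_measure. Qed.

Let mu_ge0 A : 0 <= mu A.
Proof. by rewrite fine_ge0. Qed.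

Let mu0 : mu set0 = 0.
Proof. by rewrite /mu measure0. Qed.

Let mu_le A B : measurable A -> measurable B -> A `<=` B -> mu A <= mu B.
Proof.
move=> mA mB AB; rewrite -lee_fin -!muE//.
by apply: le_measure => //; rewrite inE.
Qed.

Let mu_le1 A : measurable A -> mu A <= 1.
Proof. by move=> mA; rewrite -lee_fin -muE// probability_le1. Qed.

Let muU A B : measurable A -> measurable B -> A `&` B = set0 ->
  mu (A `|` B) = mu A + mu B.
Proof.
move=> mA mB AB; apply: EFin_inj; rewrite EFinD -!muE//; last exact: measurableU.
exact: measureU.
Qed.

Let muD A B : measurable A -> measurable B -> B `<=` A -> mu (A `\` B) = mu A - mu B.
Proof.
move=> mA mB BA; have mAB : measurable (A `\` B) by exact: measurableD.
have : mu (B `|` (A `\` B)) = mu B + mu (A `\` B).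
  by apply: muU => //; rewrite setDIK.
by rewrite setDUK// => ->; ring.
Qed.

Let exists_half A : measurable A -> 0 < mu A ->
  exists B, [/\ measurable B, B `<=` A, 0 < mu B & mu B <= mu A / 2].
Proof.
move=> mA A0; have A0' : (0 < P A)%E by rewrite muE// lte_fin.
have [B [mB BA B0 BAlt]] := P_atomless mA A0'.
rewrite muE// lte_fin in B0; rewrite !muE// lte_fin in BAlt.
have [h|h] := lerP (mu B) (mu A / 2); first by exists B.
exists (A `\` B); split; first exact: measurableD.
- by move=> x [].
- by rewrite muD// subr_gt0.
- by rewrite muD//; lra.
Qed.

Let exists_small A e : measurable A -> 0 < mu A -> 0 < e ->
  exists B, [/\ measurable B, B `<=` A, 0 < mu B & mu B < e].
Proof.
move=> mA A0 e0.
have step n : exists B, [/\ measurable B, B `<=` A, 0 < mu B & n.+1%:R * mu B <= 1].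
  elim: n => [|n [B [mB BA B0 Bn]]].
    by exists A; split => //; rewrite mul1r mu_le1.
  have [C [mC CB C0 CB2]] := exists_half mB B0.
  exists C; split => //; first exact: subset_trans BA.
  apply: le_trans Bn; rewrite -[n.+2%:R]natr1 -[n.+1%:R]natr1.
  have : 0 <= n%:R * mu B by rewrite mulr_ge0.
  have : n%:R * mu C <= n%:R * (mu B / 2) by rewrite ler_wpM2l.
  by lra.
have [B [mB BA B0 Bn]] := step (Num.truncn e^-1).
exists B; split => //.
rewrite -(ltr_pM2l (_ : 0 < (Num.truncn e^-1).+1%:R))//.
apply: (le_lt_trans Bn); rewrite -ltr_pdivrMr// mul1r.
exact: truncnS_gt.
Qed.

(** Sierpinski's theorem, by exhaustion: keep adding a subset of the remaining part
    that is at least half as large as any that still fits.  If the union fell short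
    of p, a small set of positive measure would fit at every stage, and the stages
    would have an infinite total measure. *)
Lemma sierpinski A p : measurable A -> 0 <= p <= fine (P A) ->
  exists B, [/\ measurable B, B `<=` A & P B = p%:E].
Proof.
move=> mA /andP[p0 pA].
pose valid B := [/\ measurable B, B `<=` A & mu B <= p].
pose room B C := [/\ measurable C, C `<=` A `\` B & mu C <= p - mu B].
have greedy B : exists C, valid B -> room B C /\ forall D, room B D -> mu D <= 2 * mu C.
  have [[mB BA Bp]|nv] := pselect (valid B); last by exists set0.
  pose S := [set mu C | C in [set C | room B C]].
  have S0 : S 0.
    by exists set0 => //; split => //; rewrite ?mu0 ?subr_ge0//; exact: measurable0.
  have Sub : ubound S (p - mu B) by move=> _ [C [_ _ ?] <-].
  have supS : has_sup S by split; [exists 0|exists (p - mu B)].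
  have sup_ge D : room B D -> mu D <= sup S.
    by move=> rD; apply: sup_upper_bound => //; exists D.
  have [S_gt0|S_le0] := ltrP 0 (sup S).
    have [_ [C rC <-] hC] := sup_adherent (divr_gt0 S_gt0 (ltr0n R 2)) supS.
    by exists C => _; split => // D /sup_ge; lra.
  exists set0 => _; split.
    by split => //; rewrite ?mu0 ?subr_ge0//; exact: measurable0.
  by move=> D /sup_ge; rewrite mu0; lra.
have [f hf] := choice greedy.
pose Bs n := iter n (fun B => B `|` f B) set0.
have valid_Bs n : valid (Bs n).
  elim: n => [|n vB]; first by split; rewrite /Bs /= ?mu0.
  have [[mC CAB Cp] _] := hf _ vB; case: vB => mB BA Bp.
  split; first exact: measurableU.
  - by move=> x [/BA//|/CAB[]].
  - rewrite muU//; first by lra.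
    by rewrite -subset0 => x [Bx /CAB[]].
have mBs n : measurable (Bs n) by case: (valid_Bs n).
have Bs_incr n : Bs n `<=` Bs n.+1 by move=> x; left.
have Bs_mono m n : (m <= n)%N -> Bs m `<=` Bs n.
  move=> mn; rewrite -(subnK mn); elim: (n - m)%N => // k IH.
  by apply: subset_trans IH _; exact: Bs_incr.
pose B := \bigcup_n Bs n.
have mB : measurable B by exact: bigcupT_measurable.
have BA : B `<=` A by move=> x [n _ Bx]; case: (valid_Bs n) => _ + _; apply.
have Bn n : Bs n `<=` B by move=> x Bx; exists n.
have Bp : mu B <= p.
  rewrite -lee_fin -muE//.
  have cv : P \o Bs @ \oo --> P B.
    apply: nondecreasing_cvg_mu => //.
    by move=> m n mn; apply/subsetPset; exact: Bs_mono.
  apply: cvge_to_le cv _; near=> n.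
  by have [mBn _ ?] := valid_Bs n; rewrite /= muE// lee_fin.
exists B; split => //; rewrite muE//; congr (_%:E); apply/eqP; rewrite eq_le Bp /=.
rewrite leNgt; apply/negP => Blt.
have mAB : measurable (A `\` B) by exact: measurableD.
have AB0 : 0 < mu (A `\` B) by rewrite muD// subr_gt0 (lt_le_trans Blt).
have pB0 : 0 < p - mu B by rewrite subr_gt0.
have [D [mD DAB D0 Dlt]] := exists_small mAB AB0 pB0.
have grow n : n%:R * mu D <= 2 * mu (Bs n).
  elim: n => [|n IH]; first by rewrite mul0r mulr_ge0.
  have [[mC CAB Cp] hC] := hf _ (valid_Bs n).
  have rD : room (Bs n) D.
    split => //; first by move=> x /DAB[Ax nBx]; split => // /Bn.
    apply: (le_trans (ltW Dlt)); rewrite lerD2l lerN2; exact: mu_le.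
  have -> : mu (Bs n.+1) = mu (Bs n) + mu (f (Bs n)).
    by rewrite /= muU//; rewrite -subset0 => x [Bx /CAB[]].
  have := hC _ rD; rewrite -natr1; lra.
have := grow (Num.truncn (2 / mu D)).+1.
rewrite leNgt => /negP; apply.
apply: (@le_lt_trans _ _ 2).
  by have := mu_le1 (mBs (Num.truncn (2 / mu D)).+1); lra.
by rewrite -ltr_pdivrMr//; exact: truncnS_gt.
Unshelve. all: by end_near. Qed.

Let exists_middle (AB : set T * set T) : exists M,
  measurable AB.1 -> measurable AB.2 -> AB.1 `<=` AB.2 ->
  [/\ measurable M, AB.1 `<=` M, M `<=` AB.2 & mu M = (mu AB.1 + mu AB.2) / 2].
Proof.
case: AB => A B /=.
have [[mA [mB AB]]|h] := pselect (measurable A /\ measurable B /\ A `<=` B); last first.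
  by exists set0 => mA mB AB; case: h.
have AleB := mu_le mA mB AB.
have mBA : measurable (B `\` A) by exact: measurableD.
have [|D [mD DBA PD]] := @sierpinski (B `\` A) ((mu B - mu A) / 2) mBA.
  by rewrite -/(mu (B `\` A)) muD//; apply/andP; split; lra.
exists (A `|` D) => _ _ _; split; first exact: measurableU.
- by move=> x; left.
- by move=> x [/AB//|/DBA[]].
- rewrite muU//; last by rewrite -subset0 => x [Ax /DBA[_ /(_ Ax)]].
  have -> : mu D = (mu B - mu A) / 2 by rewrite {1}/mu PD.
  by lra.
Qed.

Let exists_dyadic_chain : exists C : nat -> nat -> set T,
  [/\ forall n k, measurable (C n k),
      forall n j k, (j <= k)%N -> C n j `<=` C n k,
      forall n k, C n.+1 k.*2 = C n k,
      C 0%N 1%N = setT &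
      forall n k, (k <= 2 ^ n)%N -> mu (C n k) = k%:R / 2 ^+ n].
Proof.
have [mid hmid] := choice exists_middle.
pose C := fix C n := match n with
  | 0%N => fun k : nat => if k == 0%N then set0 else setT
  | n.+1 => fun k : nat => if odd k then mid (C n k./2, C n k./2.+1) else C n k./2
  end.
have CS n k : C n.+1 k = if odd k then mid (C n k./2, C n k./2.+1) else C n k./2 by [].
have chain n : (forall k, measurable (C n k)) /\ (forall k, C n k `<=` C n k.+1).
  elim: n => [|n [mC sC]].
    by split=> -[|k]; [exact: measurable0|exact: measurableT|exact: sub0set|].
  have hm k := hmid (C n k, C n k.+1) (mC k) (mC k.+1) (sC k).
  split=> k; rewrite !CS; first by case: odd => //; case: (hm k./2).
  rewrite /= uphalf_half; case: (boolP (odd k)) => ok /=.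
    by case: (hm k./2).
  by case: (hm k./2).
exists C; split.
- by move=> n k; case: (chain n).
- move=> n j k jk; rewrite -(subnK jk); elim: (k - j)%N => // i IH.
  by apply: subset_trans IH _; case: (chain n).
- by move=> n k; rewrite CS odd_double doubleK.
- by [].
elim=> [|n IH] k kn.
  case: k kn => [|[|]]// _; rewrite /C /= ?mu0 ?mul0r//.
  by rewrite /mu probability_setT divr1.
have [mC sC] := chain n.
rewrite CS exprS; have := odd_double_half k; case: (boolP (odd k)) => ok /=.
  rewrite add1n => kE.
  have hn : (k./2 < 2 ^ n)%N by move: kn; rewrite -kE expnS; lia.
  have [_ _ _ ->] := hmid (C n k./2, C n k./2.+1) (mC _) (mC _) (sC _).
  rewrite /= !IH// 1?ltnW// -{3}kE -!natr1 -mul2n natrM.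
  by field; rewrite expf_neq0.
rewrite add0n => kE; rewrite IH; last by move: kn; rewrite -{1}kE expnS; lia.
rewrite -{2}kE -mul2n natrM.
by field; rewrite expf_neq0.
Qed.

(** A uniform variable is the first dyadic level at which a point enters a chain of
    events C n k of probability k / 2^n. *)
Lemma exists_uniform : exists U : T -> R, [/\ measurable_fun setT U,
  forall w, 0 <= U w <= 1 &
  forall x, 0 <= x <= 1 -> P [set w | U w < x] = x%:E].
Proof.
have [C [mC sC C2 C1 muC]] := exists_dyadic_chain.
have C2m n m k : C (m + n)%N (k * 2 ^ m)%N = C n k.
  elim: m => [|m IH]; first by rewrite muln1.
  by rewrite expnS mulnCA mul2n C2 IH.
have sub n k m j : (k * 2 ^ m <= j * 2 ^ n)%N -> C n k `<=` C m j.
  by move=> h; rewrite -(C2m n m k) -(C2m m n j) addnC; exact: sC.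
pose S w := [set x : R | exists n k, C n k w /\ x = k%:R / 2 ^+ n].
have S1 w : S w 1 by exists 0%N, 1%N; rewrite C1; split => //; rewrite divr1.
have S_ge0 w x : S w x -> 0 <= x by move=> [n [k [_ ->]]]; rewrite divr_ge0// exprn_ge0.
have infS w : has_inf (S w).
  by split; [exists 1; exact: S1|exists 0 => x /S_ge0].
pose U w := inf (S w).
have U_lt w x : (U w < x) <-> exists n k, C n k w /\ k%:R / 2 ^+ n < x.
  split.
    by move=> /(inf_lt (infS w).1)[_ [n [k [Ckn ->]]] lt]; exists n, k.
  move=> [n [k [Ckn lt]]]; apply: le_lt_trans lt.
  by apply: ge_inf; [case: (infS w)|exists n, k].
have U_ltE x : [set w | U w < x] =
    \bigcup_n \bigcup_k (if k%:R / 2 ^+ n < x then C n k else set0).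
  apply/seteqP; split => w /=.
    by move=> /U_lt[n [k [Ckn lt]]]; exists n => //; exists k => //; rewrite lt.
  move=> [n _ [k _]]; case: ifPn => // lt Ckn; apply/U_lt; by exists n, k.
have mU_lt x : measurable [set w | U w < x].
  rewrite U_ltE; apply: bigcupT_measurable => n; apply: bigcupT_measurable => k.
  by case: ifP.
exists U; split.
- apply: (measurability (@RGenInftyO.G R)) => [|/= _ [_] [r] -> <-].
    exact: RGenInftyO.measurableE.
  rewrite setTI; have -> : U @^-1` `]-oo, r[%classic = [set w | U w < r].
    by apply/seteqP; split => w /=; rewrite in_itv.
  exact: mU_lt.
- move=> w; apply/andP; split.
    by apply: lb_le_inf; [exists 1; exact: S1|move=> x /S_ge0].
  by apply: ge_inf; [case: (infS w)|exact: S1].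
move=> x /andP[x0 x1]; rewrite muE//; congr (_%:E).
have p2 n : 0 < 2 ^+ n :> R by rewrite exprn_gt0.
(* Away from the ends of [0, 1], the event U < x lies between C n (t - 1) and C n (t + 1),
   t the integer part of x 2^n; the probability of each is within 2 / 2^n of x. *)
have lower n : x - 2 / 2 ^+ n <= mu [set w | U w < x].
  have /andP[t1 t2] := truncn_itv (mulr_ge0 x0 (ltW (p2 n))).
  set t := Num.truncn _ in t1 t2.
  have [t0|t0] := posnP t.
    apply: le_trans (mu_ge0 _); rewrite subr_le0 ler_pdivlMr//.
    by move: t2; rewrite t0; lra.
  have tP : t.-1%:R = t%:R - 1 :> R by rewrite -subn1 natrB.
  apply: (@le_trans _ _ (mu (C n t.-1))).
    rewrite muC; last first.
      rewrite -(ler_nat R) natrX tP; apply: (@le_trans _ _ t%:R); first by lra.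
      by apply: (le_trans t1); rewrite ler_piMl// ltW.
    rewrite ler_pdivlMr// mulrBl divfK ?gt_eqF// tP; move: t2; rewrite -natr1; lra.
  apply: mu_le => // w Cw; apply/U_lt; exists n, t.-1; split => //.
  by rewrite ltr_pdivrMr// tP; lra.
have upper n : mu [set w | U w < x] <= x + 2 / 2 ^+ n.
  have [x1'|x1'] := ltrP x 1; last first.
    apply: (@le_trans _ _ 1); first exact: mu_le1.
    by apply: (le_trans x1'); rewrite lerDl divr_ge0// ltW.
  have /andP[t1 t2] := truncn_itv (mulr_ge0 x0 (ltW (p2 n))).
  set t := Num.truncn _ in t1 t2.
  have tn : (t < 2 ^ n)%N.
    by rewrite -(ltr_nat R) natrX (le_lt_trans t1)// gtr_pMl.
  apply: (@le_trans _ _ (mu (C n t.+1))).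
    apply: mu_le => // w /U_lt[m [k [Ckm lt]]]; apply: sub Ckm.
    rewrite -(ler_nat R) !natrM !natrX -ler_pdivrMr// mulrAC -ler_pdivlMr//.
    apply/ltW/(lt_trans lt); rewrite ltr_pdivlMr//.
  rewrite muC// ler_pdivrMr// mulrDl divfK ?gt_eqF// -natr1; lra.
have small (e : R) : 0 < e -> exists n, 2 / 2 ^+ n < e.
  move=> e0; exists (Num.truncn (2 / e)).
  apply: (@le_lt_trans _ _ (2 / (Num.truncn (2 / e)).+1%:R)).
    by rewrite ler_pM2l// lef_pV2 ?posrE// -natrX ler_nat ltn_expl.
  by rewrite ltr_pdivrMr// mulrC -ltr_pdivrMr//; exact: truncnS_gt.
apply/eqP; rewrite eq_le; apply/andP; split; rewrite leNgt; apply/negP => lt.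
  have [|n hn] := small (mu [set w | U w < x] - x); first by rewrite subr_gt0.
  by have := upper n; lra.
have [|n hn] := small (x - mu [set w | U w < x]); first by rewrite subr_gt0.
by have := lower n; lra.
Qed.
End Sierpinski.

(** * Interval exchanges of a uniform variable *)

Section UniformLaw.
Context d (T : measurableType d) (R : realType) (P : probability T R).

Lemma uniform_prob_ray (x : R) :
  uniform_prob (@ltr01 R) `]-oo, x[%classic = (Num.max 0 (Num.min 1 x))%:E.
Proof.
rewrite /uniform_prob integral_uniform_pdf.
rewrite (eq_integral (fun=> 1%E)); last first.
  move=> y; rewrite inE => -[_]; rewrite /= in_itv /= /uniform_pdf => ->.
  by rewrite subr0 invr1.
rewrite integral_cst; last exact: measurableI.
rewrite mul1e /=.
have [x0|x0] := lerP x 0.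
  have -> : `]-oo, x[%classic `&` `[0, 1]%classic = set0 :> set R.
    rewrite -subset0 => y [] /=; rewrite !in_itv /= => yx /andP[y0 _].
    by have := lt_le_trans yx x0; rewrite ltNge y0.
  by rewrite measure0 max_l// ge_min x0 orbT.
have [x1|x1] := lerP 1 x.
  have [x1'|x1'] := ltrP 1 x.
    have -> : `]-oo, x[%classic `&` `[0, 1]%classic = `[0, 1]%classic :> set R.
      apply/seteqP; split => [y []//|y] /=; rewrite !in_itv /= => /andP[y0 y1].
      by rewrite y0 y1 (le_lt_trans y1 x1').
    by rewrite lebesgue_measure_itv /= lte_fin ltr01 oppr0 adde0 max_r.
  have -> : x = 1 by apply/eqP; rewrite eq_le x1 x1'.
  have -> : `]-oo, 1[%classic `&` `[0, 1]%classic = `[0, 1[%classic :> set R.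
    apply/seteqP; split => [y [] /=|y] /=; rewrite !in_itv /=.
      by move=> -> /andP[->].
    by move=> /andP[-> y1]; rewrite y1 ltW.
  by rewrite lebesgue_measure_itv /= lte_fin ltr01 oppr0 adde0 max_r.
have -> : `]-oo, x[%classic `&` `[0, 1]%classic = `[0, x[%classic :> set R.
  apply/seteqP; split => [y [] /=|y] /=; rewrite !in_itv /=.
    by move=> -> /andP[->].
  by move=> /andP[-> yx]; rewrite yx (le_trans (ltW yx) (ltW x1)).
by rewrite lebesgue_measure_itv /= lte_fin x0 oppr0 adde0 max_r// ltW.
Qed.

Lemma uniform01_of_ray (U : {RV P >-> R}) : (forall w, 0 <= U w <= 1) ->
  (forall x, 0 <= x <= 1 -> P [set w | U w < x] = x%:E) -> uniform01 U.
Proof.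
move=> U01 hU; split=> // A mA.
have ray x : distribution P U `]-oo, x[%classic = P [set w | U w < x].
  by congr (P _); apply/seteqP; split => w /=; rewrite in_itv.
(* measurableTypeR R and R have the same measurable sets, but uniform_prob is a
   measure on the former only *)
have mU : measurable_fun setT (U : T -> measurableTypeR R).
  exact: (@measurable_funPT _ _ _ _ U).
pose U' : {mfun T >-> measurableTypeR R} := @mfun_Sub _ _ T (measurableTypeR R) U (mem_set mU).
rewrite -[distribution P U A]/(distribution P U' A).
apply: (@measure_unique _ R (measurableTypeR R) (@RGenInftyO.G R)
  (fun n => `]-oo, n%:R[%classic) _ _ _ _ (distribution P U') (uniform_prob (@ltr01 R))) => //.
- exact: RGenInftyO.measurableE.
- move=> _ _ [x ->] [y ->]; exists (Num.min x y).
  apply/seteqP; split => z /=; rewrite !in_itv /= lt_min; first by move=> [-> ->].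
  by move=> /andP[].
- by move=> n; exists n%:R.
- rewrite -subTset => x _; exists (Num.truncn x).+1 => //=.
  by rewrite in_itv /=; exact: truncnS_gt.
- move=> _ [x ->]; transitivity (P [set w | U w < x]); first exact: ray.
  transitivity ((Num.max 0 (Num.min 1 x))%:E); last by rewrite -uniform_prob_ray.
  have [x0|x0] := lerP 0 x.
    have [x1|x1] := lerP 1 x.
      have [x1'|x1'] := ltrP 1 x.
        rewrite max_r// (_ : [set w | _] = setT) ?probability_setT//.
        by apply/seteqP; split => w //= _; have /andP[_ /le_lt_trans] := U01 w; apply.
      have -> : x = 1 by apply/eqP; rewrite eq_le x1 x1'.
      by rewrite max_r// hU// lexx ler01.
    by rewrite max_r// hU// x0 ltW.
  rewrite max_l; last by rewrite ge_min (ltW x0) orbT.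
  rewrite (_ : [set w | _] = set0) ?measure0//.
  rewrite -subset0 => w /= wx; have /andP[w0 _] := U01 w.
  by have := lt_trans wx x0; rewrite ltNge w0.
- by move=> n; rewrite (le_lt_trans _ (ltry 1))// probability_le1.
Qed.
End UniformLaw.

Section IntervalExchange.
Context d (T : measurableType d) (R : realType) (P : probability T R).
Variables (U : T -> R) (e : R) (m : nat).
Hypotheses (mU : measurable_fun setT U) (U01 : forall w, 0 <= U w <= 1)
  (U_ray : forall x, 0 <= x <= 1 -> P [set w | U w < x] = x%:E)
  (e01 : 0 < e <= 1) (m0 : (0 < m)%N).

Let h := e / m%:R.
Let cell (i : nat) := [set w | i%:R * h <= U w < i.+1%:R * h].

Let mR : 0 < m%:R :> R. Proof. by rewrite ltr0n. Qed.
Let e0 : 0 < e. Proof. by case/andP: e01. Qed.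
Let h0 : 0 < h. Proof. by rewrite divr_gt0. Qed.
Let mh : m%:R * h = e. Proof. by rewrite mulrC divfK// gt_eqF. Qed.

Let mray x : measurable [set w | U w < x].
Proof.
have -> : [set w | U w < x] = U @^-1` `]-oo, x[%classic.
  by apply/seteqP; split => w /=; rewrite in_itv.
by rewrite -[X in measurable X]setTI; exact: mU.
Qed.

Let cellE i : cell i = [set w | U w < i.+1%:R * h] `\` [set w | U w < i%:R * h].
Proof.
apply/seteqP; split => w /=; rewrite /cell /=.
  by move=> /andP[lo hi]; split=> //; apply/negP; rewrite -leNgt.
by move=> [hi /negP]; rewrite -leNgt => lo; rewrite lo hi.
Qed.

Let mcell i : measurable (cell i).
Proof. by rewrite cellE; exact: measurableD. Qed.

Lemma exists_cell w : U w < e -> exists i : 'I_m, i%:R * h <= U w < i.+1%:R * h.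
Proof.
move=> we; have /andP[w0 _] := U01 w.
have /andP[t1 t2] := truncn_itv (divr_ge0 w0 (ltW h0)).
rewrite ler_pdivlMr// in t1; rewrite ltr_pdivrMr// in t2.
have tm : (Num.truncn (U w / h) < m)%N.
  by rewrite -(ltr_nat R) -(ltr_pM2r h0) mh (le_lt_trans t1).
by exists (Ordinal tm); rewrite /= t1 t2.
Qed.

Let cell_split E : measurable E ->
  P E = (\sum_(i < m) P (E `&` cell i) + P (E `\` [set w | (U w < e)%R]))%E.
Proof.
move=> mE.
have below k : P (E `&` [set w | (U w < k%:R * h)%R]) = (\sum_(i < k) P (E `&` cell i))%E.
  elim: k => [|k IH].
    rewrite big_ord0 mul0r (_ : _ `&` _ = set0) ?measure0//.
    rewrite -subset0 => w [_ /=]; have /andP[w0 _] := U01 w.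
    by rewrite ltNge w0.
  rewrite big_ord_recr /= -IH -measureU.
  - congr (P _); rewrite -setIUr; congr (_ `&` _).
    rewrite cellE setDUK// => w /= /lt_trans; apply.
    by rewrite ltr_pM2r// ltr_nat.
  - exact: measurableI.
  - exact: measurableI.
  - rewrite -subset0 => w [[_ /= lt] [_ /andP[le _]]].
    by move: lt; rewrite ltNge le.
rewrite -below mh -measureU//.
- by rewrite setUIDK.
- exact: measurableI.
- exact: measurableD.
- by rewrite -subset0 => w [[_ lt] [_ nlt]].
Qed.

Let cell_ray i y : (i < m)%N ->
  P ([set w | U w < y] `&` cell i) = (Num.max 0 (Num.min h (y - i%:R * h)))%:E.
Proof.
move=> im.
have ih0 : 0 <= i%:R * h by rewrite mulr_ge0// ltW.
have Sh : i.+1%:R * h = i%:R * h + h by rewrite -natr1 mulrDl mul1r.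
have Sh1 : i.+1%:R * h <= 1.
  by case/andP: e01 => _; apply: le_trans; rewrite -mh ler_pM2r// ler_nat.
pose z := Num.min (i.+1%:R * h) y.
have -> : Num.min h (y - i%:R * h) = z - i%:R * h.
  by rewrite /z Sh; have [?|?] := lerP h (y - i%:R * h);
    have [?|?] := lerP (i%:R * h + h) y; lra.
have -> : [set w | U w < y] `&` cell i = [set w | U w < z] `\` [set w | U w < i%:R * h].
  apply/seteqP; split => w /=; rewrite /cell /= lt_min.
    by move=> [lt /andP[lo hi]]; rewrite lt hi; split=> //; apply/negP; rewrite -leNgt.
  by move=> [/andP[-> ->] /negP]; rewrite -leNgt => ->.
have [zi|zi] := lerP z (i%:R * h).
  rewrite max_l ?subr_le0// (_ : _ `\` _ = set0) ?measure0//.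
  by rewrite -subset0 => w [/= /lt_le_trans/(_ zi)].
rewrite max_r ?subr_ge0 ?ltW//.
have z1 : z <= 1 by rewrite ge_min Sh1.
have zi1 : i%:R * h <= 1 by rewrite (le_trans (ltW zi)).
have -> : (z - i%:R * h)%:E =
    (P [set w | (U w < z)%R] - P [set w | (U w < i%:R * h)%R])%E.
  by rewrite !U_ray ?EFinB ?ih0 ?z1 ?(le_trans ih0 (ltW zi)).
rewrite measureD//; last by rewrite (le_lt_trans _ (ltry 1))// probability_le1.
by rewrite setIidr// => w /= /lt_trans; apply.
Qed.

Variable sg : 'I_m -> 'I_m.
Hypothesis sg_inj : injective sg.

Let shift x := x + \sum_(i < m) h * ((sg i)%:R - i%:R) *
  \1_(`[i%:R * h, i.+1%:R * h[%classic) x.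

Let shift_in (i : 'I_m) x : i%:R * h <= x < i.+1%:R * h ->
  shift x = x + h * ((sg i)%:R - i%:R).
Proof.
move=> xi; rewrite /shift (bigD1 i)//= indicE mem_set ?mulr1; last by rewrite /= in_itv.
rewrite big1 ?addr0// => j ji; rewrite indicE memNset ?mulr0//= in_itv /=.
move=> /andP[xj1 xj2]; case/andP: xi => xi1 xi2; move/eqP: ji; apply; apply: val_inj => /=.
have := le_lt_trans xj1 xi2; have := le_lt_trans xi1 xj2.
by rewrite !ltr_pM2r// !ltr_nat !ltnS => ij ji; apply/eqP; rewrite eqn_leq ij ji.
Qed.

Let shift_out x : e <= x -> shift x = x.
Proof.
move=> ex; rewrite /shift big1 ?addr0// => i _; rewrite indicE memNset ?mulr0//= in_itv /=.
move=> /andP[_]; rewrite ltNge => /negP; apply; apply: le_trans ex.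
by rewrite -mh ler_pM2r// ler_nat.
Qed.

Let mshift : measurable_fun setT shift.
Proof.
apply: measurable_funD; first exact: measurable_id.
apply: measurable_sum => i; apply: measurable_funM; first exact: measurable_cst.
by apply: measurable_indic; exact: measurable_itv.
Qed.

Let shift_cell (i : 'I_m) w : cell i w ->
  (sg i)%:R * h <= shift (U w) < (sg i).+1%:R * h.
Proof.
by move=> wi; rewrite (shift_in wi); move: wi; rewrite /cell /= -!natr1 => /andP[? ?];
  apply/andP; split; lra.
Qed.

(** The law is preserved because [0, e) is cut into m cells of equal length, which are
    translated onto one another. *)
Lemma interval_exchange : exists V : {RV P >-> R}, uniform01 V /\
  forall (i : 'I_m) w, cell i w -> V w <= e * ((sg i).+1%:R / m%:R).
Proof.
have mV : measurable_fun setT (shift \o U) by exact: measurableT_comp.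
pose V : {RV P >-> R} := mfun_Sub (mem_set mV).
have VE w : V w = shift (U w) by [].
exists V; split; last first.
  move=> i w /shift_cell /andP[_ /ltW]; rewrite VE /h; lra.
have le1 (i : 'I_m) : i.+1%:R * h <= 1.
  by case/andP: e01 => _; apply: le_trans; rewrite -mh ler_pM2r// ler_nat.
apply: uniform01_of_ray => [w|x x01].
  rewrite VE; have [ew|/exists_cell[i /shift_cell /andP[lo hi]]] := lerP e (U w).
    by rewrite shift_out.
  apply/andP; split; first by rewrite (le_trans _ lo)// mulr_ge0// ltW.
  exact: le_trans (ltW hi) (le1 _).
have mVx : measurable [set w | V w < x].
  have -> : [set w | V w < x] = V @^-1` `]-oo, x[%classic.
    by apply/seteqP; split => w /=; rewrite in_itv.
  by rewrite -[X in measurable X]setTI; exact: (@measurable_funPT _ _ _ _ V).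
rewrite -(U_ray x01) (cell_split mVx) (cell_split (mray x)); congr (_ + _)%E.
  rewrite [RHS](reindex_inj sg_inj); apply: eq_bigr => i _.
  rewrite (_ : _ `&` cell i = [set w | U w < x - h * ((sg i)%:R - i%:R)] `&` cell i).
    by rewrite !cell_ray//; congr (Num.max 0 (Num.min h _))%:E; ring.
  apply/seteqP; split => w /= [lt wi]; split => //; move: lt; rewrite /= (shift_in wi); lra.
congr (P _); apply/seteqP; split => w [lt nlt]; split => //.
  by move: lt; rewrite /= shift_out// leNgt; apply/negP.
by rewrite /= shift_out// leNgt; apply/negP.
Qed.
End IntervalExchange.

(** * Box-Cox test functions *)

Section UniformExpectation.
Context d (T : measurableType d) (R : realType) (P : probability T R).

Lemma integral_uniform01 (U : {RV P >-> R}) (g : R -> R) : uniform01 U ->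
  measurable_fun setT g -> (forall x, 0 <= g x) ->
  (\int[P]_w (g (U w))%:E = \int[lebesgue_measure]_(x in `[0%R, 1%R]) (g x)%:E)%E.
Proof.
move=> [_ lawU] mg g0.
(* as a variable in measurableTypeR R, U has a law that can be compared with
   uniform_prob *)
have mU : measurable_fun setT (U : T -> measurableTypeR R).
  exact: (@measurable_funPT _ _ _ _ U).
pose U' : {mfun T >-> measurableTypeR R} := @mfun_Sub _ _ T (measurableTypeR R) U (mem_set mU).
have mEg : measurable_fun setT (EFin \o g : measurableTypeR R -> \bar R).
  exact/measurable_EFinP.
transitivity (\int[distribution P U']_x (g x)%:E)%E.
  by rewrite ge0_integral_distribution.
transitivity (\int[uniform_prob (@ltr01 R)]_x (g x)%:E)%E.
  by apply: eq_measure_integral => A mA _; exact: lawU.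
by rewrite integral_uniform// subr0 invr1 mul1e.
Qed.

Lemma markov_uniform K (U : 'I_K -> {RV P >-> R}) (g : R -> R) (I b : R) (A : set T) :
  (forall k, uniform01 (U k)) -> measurable_fun setT g -> (forall x, 0 <= g x) ->
  (\int[lebesgue_measure]_(x in `[0%R, 1%R]) (g x)%:E = I%:E)%E ->
  0 < b -> measurable A -> (forall w, A w -> b <= \sum_k g (U k w)) ->
  (P A <= (K%:R * I / b)%:E)%E.
Proof.
move=> hU mg g0 hI b0 mA hA.
have mgU k : measurable_fun setT (fun w => g (U k w)).
  by apply: measurableT_comp => //; exact: (@measurable_funPT _ _ _ _ (U k)).
have mS : measurable_fun setT (fun w => (\sum_k g (U k w))%:E).
  by apply/measurable_EFinP; apply: measurable_sum.
have S0 w : (0 <= (\sum_k g (U k w))%:E)%E by rewrite lee_fin sumr_ge0.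
have step : (b%:E * P A <= (K%:R * I)%:E)%E.
  apply: (@le_trans _ _ (\int[P]_(w in A) (\sum_k g (U k w))%:E)%E).
    rewrite -integral_cst//; apply: ge0_le_integral => //.
    - by move=> w _; rewrite lee_fin ltW.
    - exact: measurable_funTS.
  apply: (@le_trans _ _ (\int[P]_w (\sum_k g (U k w))%:E)%E).
    exact: ge0_subset_integral.
  under eq_integral do rewrite -sumEFin.
  rewrite ge0_integral_sum//.
  - under eq_bigr do rewrite integral_uniform01// hI.
    by rewrite sumEFin sumr_const card_ord mulr_natl.
  - by move=> k; exact/measurable_EFinP.
  - by move=> k w _; rewrite lee_fin.
have -> : P A = (fine (P A))%:E by rewrite fineK// fin_num_measure.
have -> : fine (P A) = b * fine (P A) / b by rewrite mulrAC divff ?mul1r// gt_eqF.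
rewrite lee_fin ler_pM2r ?invr_gt0// -lee_fin EFinM fineK// fin_num_measure//.
Qed.
End UniformExpectation.

Section BoxCox.
Variable R : realType.
Implicit Types (r w : R).

Definition boxcox r w : R := if r == 0 then ln w else (w `^ r - 1) / r.

(** The primitive of - boxcox r that vanishes at 0. *)
Definition boxcox_prim r w : R :=
  if r == 0 then w - w * ln w else (w - w `^ (r + 1) / (r + 1)) / r.

Lemma is_derive_boxcox_prim r w : -1 < r -> 0 < w ->
  is_derive w (1 : R) (boxcox_prim r) (- boxcox r w).
Proof.
move=> r1 w0; rewrite /boxcox_prim /boxcox.
have did := is_derive_id w (1 : R).
case: eqVneq => [_|r0].
  apply: is_derive_eq (is_deriveB did (is_deriveM did (is_derive1_ln w0))) _.
  by rewrite /GRing.scale /= divff ?gt_eqF//; ring.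
have r10 : r + 1 != 0 by rewrite gt_eqF//; lra.
have := is_deriveZ r^-1 (is_deriveB did (is_deriveZ (r + 1)^-1 (is_derive1_powR (r + 1) w0))).
rewrite (_ : _ \*: _ = fun w => (w - w `^ (r + 1) / (r + 1)) / r); last first.
  by apply/funext => x; rewrite /= /GRing.scale /= mulrC; congr (_ * _); rewrite [in RHS]mulrC.
move=> h; apply: is_derive_eq h _; rewrite /GRing.scale /= addrK.
by field; rewrite r0 r10.
Qed.

Lemma derivable_boxcox r w : 0 < w -> derivable (boxcox r) w 1.
Proof.
move=> w0; rewrite /boxcox; case: eqVneq => _.
  by have [] := is_derive1_ln w0.
have := is_deriveZ r^-1 (is_deriveB (is_derive1_powR r w0) (is_derive_cst (1 : R) w (1 : R))).
rewrite (_ : _ \*: _ = fun w => (w `^ r - 1) / r); last first.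
  by apply/funext => x; rewrite /= /GRing.scale /= mulrC.
by case.
Qed.

Lemma boxcox_prim1 r : -1 < r -> boxcox_prim r 1 = (r + 1)^-1.
Proof.
move=> r1; rewrite /boxcox_prim; case: eqVneq => [->|r0].
  by rewrite ln1 mulr0 subr0 add0r invr1.
have r10 : r + 1 != 0 by rewrite gt_eqF//; lra.
by rewrite powR1; field; rewrite r0 r10.
Qed.

Lemma boxcox_primE r w : -1 < r -> 0 < w ->
  boxcox_prim r w = w `^ (r + 1) / (r + 1) - w * boxcox r w.
Proof.
move=> r1 w0; rewrite /boxcox_prim /boxcox; case: eqVneq => [->|r0].
  by rewrite add0r powRr1 ?ltW// divr1.
have r10 : r + 1 != 0 by rewrite gt_eqF//; lra.
rewrite powRD ?powRr1 ?(ltW w0)//; last by rewrite (lt0r_neq0 w0) implybT.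
by field; rewrite r0 r10.
Qed.

Lemma boxcox_le0 r w : 0 < w <= 1 -> boxcox r w <= 0.
Proof.
move=> /andP[w0 w1]; rewrite /boxcox; case: (ltgtP r 0) => [r0|r0|_]; last by rewrite ln_le0.
  by rewrite nmulr_lle0 ?invr_lt0// subr_ge0 -[leLHS](powRr0 w) ger_powR ?w0// ltW.
by rewrite pmulr_lle0 ?invr_gt0// subr_le0 -[leRHS](powRr0 w) ger_powR ?w0// ltW.
Qed.

Lemma boxcox_ge0 r w : 1 <= w -> 0 <= boxcox r w.
Proof.
move=> w1; rewrite /boxcox; case: (ltgtP r 0) => [r0|r0|_]; last by rewrite ln_ge0.
  by rewrite nmulr_lge0 ?invr_lt0// subr_le0 -[leRHS](powRr0 w) ler_powR// ltW.
by rewrite pmulr_lge0 ?invr_gt0// subr_ge0 -[leLHS](powRr0 w) ler_powR// ltW.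
Qed.

Variables (r e a B : R).
Hypotheses (r1 : -1 < r) (e01 : 0 < e < 1) (a01 : 0 < a < 1) (B0 : 0 <= B).

(** The positive part of - boxcox r (u / e), with its values on [0, e a] replaced by
    B.  This removes the singularity at 0, and is the truncation that makes Markov's
    inequality strict for small r.  At the common point e * a both terms are present. *)
Definition dual_test (u : R) : R :=
  B * \1_(`[0, e * a]%classic) u + (- boxcox r (u / e)) * \1_(`[e * a, e]%classic) u.

Let e0 : 0 < e. Proof. by case/andP: e01. Qed.
Let a0 : 0 < a. Proof. by case/andP: a01. Qed.
Let ea0 : 0 < e * a. Proof. exact: mulr_gt0. Qed.
Let ea_lt : e * a < e. Proof. by rewrite gtr_pMr//; case/andP: a01. Qed.

Let scaled01 u : e * a <= u <= e -> 0 < u / e <= 1.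
Proof.
move=> /andP[ul ue]; have u0 := lt_le_trans ea0 ul.
by rewrite divr_gt0//= ler_pdivrMr// mul1r.
Qed.

Let second_ge0 u : 0 <= (- boxcox r (u / e)) * \1_(`[e * a, e]%classic) u.
Proof.
rewrite indicE; case: (boolP (u \in _)) => [|_]; last by rewrite mulr0.
by rewrite inE /= in_itv /= mulr1 oppr_ge0 => /scaled01; exact: boxcox_le0.
Qed.

Lemma dual_test_ge0 u : 0 <= dual_test u.
Proof. by rewrite addr_ge0// mulr_ge0// indicE. Qed.

Lemma dual_test_low u : 0 <= u <= e * a -> B <= dual_test u.
Proof.
move=> u1; rewrite /dual_test indicE mem_set ?mulr1; last by rewrite /= in_itv.
by rewrite lerDl second_ge0.
Qed.

Lemma dual_test_high u : e * a <= u -> - boxcox r (u / e) <= dual_test u.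
Proof.
move=> u1; have [ue|ue] := lerP u e.
  rewrite /dual_test [X in _ + _ * X]indicE mem_set ?mulr1; last by rewrite /= in_itv /= u1.
  by rewrite lerDr mulr_ge0// indicE.
apply: le_trans (dual_test_ge0 u); rewrite oppr_le0; apply: boxcox_ge0.
by rewrite ler_pdivlMr// mul1r ltW.
Qed.

Let mboxcox : measurable_fun setT (fun u : R => - boxcox r (u / e)).
Proof.
apply: measurable_funN; rewrite /boxcox.
have mdiv : measurable_fun setT (fun u : R => u / e).
  by apply: measurable_funM; [exact: measurable_id|exact: measurable_cst].
case: eqVneq => _; first exact: measurableT_comp.
apply: measurable_funM; last exact: measurable_cst.
apply: measurable_funB; last exact: measurable_cst.
by apply: (measurableT_comp (measurable_powR _)).
Qed.

Lemma measurable_dual_test : measurable_fun setT dual_test.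
Proof.
apply: measurable_funD; apply: measurable_funM.
- exact: measurable_cst.
- by apply: measurable_indic; exact: measurable_itv.
- exact: mboxcox.
- by apply: measurable_indic; exact: measurable_itv.
Qed.

Lemma integral_boxcox :
  (\int[lebesgue_measure]_(u in `[(e * a)%R, e]) (- boxcox r (u / e))%:E =
   (e * (boxcox_prim r 1 - boxcox_prim r a))%:E)%E.
Proof.
pose F u := e * boxcox_prim r (u / e).
have did (u : R) : is_derive u (1 : R) (fun u : R => u / e) e^-1.
  have := is_deriveZ e^-1 (is_derive_id u (1 : R)).
  rewrite (_ : _ \*: _ = fun u => u / e); last first.
    by apply/funext => x; rewrite /= /GRing.scale /= mulrC.
  by rewrite /GRing.scale /= mulr1.
have dF (u : R) : 0 < u -> is_derive u (1 : R) F (- boxcox r (u / e)).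
  move=> u0.
  have ue0 : 0 < u / e by rewrite divr_gt0.
  apply: is_derive_eq (is_deriveZ e (@is_derive1_comp R _ _ u _ _
    (is_derive_boxcox_prim r1 ue0) (did u))) _.
  by rewrite /GRing.scale /=; field; rewrite gt_eqF.
have pos u : u \in `[e * a, e] -> 0 < u by rewrite in_itv /= => /andP[/(lt_le_trans ea0)].
have cF (u : R) : 0 < u -> {for u, continuous F}.
  move=> u0; apply: differentiable_continuous; apply/derivable1_diffP.
  by have [] := dF u u0.
rewrite (@continuous_FTC2 R _ F (e * a) e ea_lt).
- rewrite /F divff ?gt_eqF// mulrAC divff ?gt_eqF// mul1r -EFinB; congr (_%:E); ring.
- apply: derivable_within_continuous => u /pos u0.
  have ue0 : 0 < u / e by rewrite divr_gt0.
  have db := derivableP (@derivable_boxcox r _ ue0).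
  by have [] := is_deriveN (@is_derive1_comp R _ _ u _ _ db (did u)).
- split.
  + move=> u; rewrite in_itv /= => /andP[/(lt_trans ea0) u0 _].
    by have [] := dF u u0.
  + apply: cvg_at_right_filter; exact: cF.
  + apply: cvg_at_left_filter; exact: cF.
- move=> u; rewrite in_itv /= => /andP[/(lt_trans ea0) u0 _].
  by rewrite derive1E; have [_ ->] := dF u u0.
Qed.

Lemma integral_dual_test :
  (\int[lebesgue_measure]_(u in `[0%R, 1%R]) (dual_test u)%:E =
   (e * (B * a + boxcox_prim r 1 - boxcox_prim r a))%:E)%E.
Proof.
have e1 : e <= 1 by case/andP: e01 => _ /ltW.
have sub1 : `[0, e * a]%classic `<=` (`[0, 1]%classic : set R).
  move=> u /=; rewrite !in_itv /= => /andP[-> ue] /=.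
  by rewrite (le_trans ue)// (le_trans (ltW ea_lt)).
have sub2 : `[e * a, e]%classic `<=` (`[0, 1]%classic : set R).
  move=> u /=; rewrite !in_itv /= => /andP[u0 ue].
  by rewrite (le_trans (ltW ea0) u0) (le_trans ue).
under eq_integral do rewrite /dual_test EFinD.
rewrite ge0_integralD//; last 4 first.
- by move=> u _; rewrite lee_fin mulr_ge0// indicE.
- apply/measurable_EFinP/measurable_funTS; apply: measurable_funM.
    exact: measurable_cst.
  by apply: measurable_indic; exact: measurable_itv.
- by move=> u _; rewrite lee_fin second_ge0.
- apply/measurable_EFinP/measurable_funTS; apply: measurable_funM; first exact: mboxcox.
  by apply: measurable_indic; exact: measurable_itv.
have -> : (\int[lebesgue_measure]_(u in `[0%R, 1%R]) (B * \1_(`[0%R, (e * a)%R]%classic) u)%:E =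
    (B * (e * a))%:E)%E.
  under eq_integral do rewrite EFinM.
  rewrite ge0_integralZl_EFin//.
    rewrite integral_indic//= setIidl// lebesgue_measure_itv /= lte_fin ea0.
    by rewrite oppr0 adde0 EFinM.
  exact/measurable_EFinP/measurable_indic.
have -> : (\int[lebesgue_measure]_(u in `[0%R, 1%R])
    (- boxcox r (u / e) * \1_(`[(e * a)%R, e]%classic) u)%:E =
    (e * (boxcox_prim r 1 - boxcox_prim r a))%:E)%E.
  rewrite -integral_boxcox -[X in (_ = \int[_]_(u in X) _)%E](setIidr sub2).
  rewrite [RHS]integral_mkcondr; apply: eq_integral => u _; rewrite patchE indicE.
  by case: ifP => _; rewrite ?mulr1 ?mulr0.
by rewrite -EFinD; congr (_%:E); ring.
Qed.
End BoxCox.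

(** * Generalized means *)

Section GeneralizedMean.
Variables (R : realType) (K : nat).
Hypothesis K0 : (0 < K)%N.
Implicit Types (r eps : R) (p q : K.-tuple R).

Let KR : 0 < K%:R :> R. Proof. by rewrite ltr0n. Qed.

Lemma le0_powR r (x y : R) : r <= 0 -> 0 < x -> x <= y -> y `^ r <= x `^ r.
Proof.
move=> r0 x0 xy; have y0 : 0 < y by apply: lt_le_trans xy.
rewrite -[r]opprK !(powRN _ (- r)) lef_pV2 ?posrE ?powR_gt0//.
by rewrite ge0_ler_powR ?oppr_ge0// nnegrE ltW.
Qed.

Lemma powR_lt1 (x c : R) : 0 <= x < 1 -> 0 < c -> x `^ c < 1.
Proof.
move=> /andP[x0 x1] c0; have <- : 1 `^ c = 1 :> R by rewrite powR1.
by rewrite gt0_ltr_powR// nnegrE.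
Qed.

Lemma gen_mean_real r p : r != 0 -> unit_cube p -> (0 < r \/ forall k, 0 < tnth p k) ->
  gen_mean r p = ((\sum_(k < K) tnth p k `^ r) / K%:R) `^ r^-1.
Proof.
move=> r0 p01 hr; rewrite /gen_mean (negbTE r0).
have xpowE (x : R) (c : R) : (x != 0) || (0 < c) -> xpow x%:E c = (x `^ c)%:E.
  by rewrite /xpow; case: eqP => //= _ c0; rewrite ltNge (ltW c0).
under eq_bigr => k _.
  rewrite xpowE; last by case: hr => [->|/(_ k)/lt0r_neq0 ->]; rewrite ?orbT.
  over.
rewrite sumEFin -EFinM xpowE//.
case: hr => [r_gt0|hp]; first by rewrite invr_gt0 r_gt0 orbT.
rewrite lt0r_neq0// divr_gt0//.
rewrite (bigD1 (Ordinal K0))//= ltr_pwDl ?powR_gt0// sumr_ge0// => k _.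
exact: powR_ge0.
Qed.

Lemma gen_mean_zero r p k : r < 0 -> tnth p k = 0 -> gen_mean r p = 0.
Proof.
move=> r0 pk; rewrite /gen_mean lt_eqF//.
have -> : (\sum_(j < K) xpow (tnth p j)%:E r)%E = +oo%E.
  rewrite (bigD1 k)//= pk eqxx r0 addye// -ltNye (@lt_le_trans _ _ 0%E)// sume_ge0// => j _.
  by case: ifP => _; rewrite ?leey// lee_fin powR_ge0.
by rewrite gt0_mulye ?lte_fin ?invr_gt0//= invr_lt0 r0.
Qed.

Lemma gen_mean_ge0 r p : 0 <= gen_mean r p.
Proof.
rewrite /gen_mean; case: ifP => _; first exact: powR_ge0.
apply: fine_ge0; rewrite /xpow; case: (_ * _)%E => [x| |] //; case: ifP => //= _.
by rewrite lee_fin powR_ge0.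
Qed.

Lemma gen_mean_le r p q : unit_cube p -> unit_cube q ->
  (forall k, tnth p k <= tnth q k) -> gen_mean r p <= gen_mean r q.
Proof.
move=> p01 q01 pq.
have p0 k : 0 <= tnth p k by case/andP: (p01 k).
have [r_lt0|r_gt0|r0] := ltgtP r 0; last first.
- rewrite /gen_mean r0 eqxx ge0_ler_powR ?invr_ge0 ?nnegrE ?prodr_ge0//.
    by move=> k _; exact: le_trans (pq k).
  by apply: ler_prod => k _; rewrite p0 pq.
- rewrite (gen_mean_real (lt0r_neq0 r_gt0) p01 (or_introl r_gt0)).
  rewrite (gen_mean_real (lt0r_neq0 r_gt0) q01 (or_introl r_gt0)).
  rewrite ge0_ler_powR ?invr_ge0 ?nnegrE ?divr_ge0 ?sumr_ge0 ?(ltW r_gt0)//.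
  + by move=> k _; exact: powR_ge0.
  + by move=> k _; exact: powR_ge0.
  + rewrite ler_pM2r ?invr_gt0//; apply: ler_sum => k _.
    by rewrite ge0_ler_powR ?(ltW r_gt0)// nnegrE// (le_trans (p0 k)).
have [[k pk]|/forallNP np] := pselect (exists k, tnth p k = 0).
  by rewrite (gen_mean_zero r_lt0 pk) gen_mean_ge0.
have pp k : 0 < tnth p k by rewrite lt_neqAle p0 andbT eq_sym; apply/eqP/np.
have qp k : 0 < tnth q k by exact: lt_le_trans (pq k).
have sum_gt0 (x : K.-tuple R) : (forall k, 0 < tnth x k) ->
    0 < (\sum_(k < K) tnth x k `^ r) / K%:R.
  move=> hx; rewrite divr_gt0// (bigD1 (Ordinal K0))//= ltr_pwDl ?powR_gt0//.
  by rewrite sumr_ge0// => k _; exact: powR_ge0.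
rewrite (gen_mean_real (ltr0_neq0 r_lt0) p01 (or_intror pp)).
rewrite (gen_mean_real (ltr0_neq0 r_lt0) q01 (or_intror qp)).
apply: le0_powR; rewrite ?invr_le0 ?(ltW r_lt0) ?sum_gt0//.
rewrite ler_pM2r ?invr_gt0//; apply: ler_sum => k _.
by apply: le0_powR; rewrite ?(ltW r_lt0).
Qed.

Lemma mean_const_ge0 r : 0 <= mean_const r.
Proof. by rewrite /mean_const; case: ifP => _; rewrite ?powR_ge0 ?expR_ge0. Qed.

Lemma mean_powE r p : -1 < r -> r != 0 -> unit_cube p -> (0 < r \/ forall k, 0 < tnth p k) ->
  mean_const r * gen_mean r p =
  ((r + 1) * ((\sum_(k < K) tnth p k `^ r) / K%:R)) `^ r^-1.
Proof.
move=> r1 r0 p01 hr; have rp : 0 <= r + 1 by lra.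
rewrite (gen_mean_real r0 p01 hr) /mean_const (negbTE r0) [RHS]powRM//.
by rewrite divr_ge0// sumr_ge0// => k _; exact: powR_ge0.
Qed.

(** The image under boxcox r of the inequality, at the scale eps.  The case r <= 0 with
    a zero coordinate is left out: there the mean is 0. *)
Lemma mean_le_sum_boxcox r eps p : -1 < r -> 0 < eps -> unit_cube p ->
  (0 < r \/ forall k, 0 < tnth p k) -> mean_const r * gen_mean r p <= eps ->
  K%:R / (r + 1) <= \sum_(k < K) - boxcox r (tnth p k / eps).
Proof.
move=> r1 eps0 p01 hr; have rp : 0 < r + 1 by lra.
have p0 k : 0 <= tnth p k by case/andP: (p01 k).
have [r0|r0] := eqVneq r 0.
  case: hr => [|pp]; first by rewrite r0 ltxx.
  rewrite r0 add0r divr1 /mean_const /gen_mean eqxx /boxcox eqxx => le_eps.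
  have prod_gt0 : 0 < \prod_(k < K) tnth p k by apply: prodr_gt0.
  have : ln (expR 1 * (\prod_(k < K) tnth p k) `^ K%:R^-1) <= ln eps.
    by rewrite ler_ln// posrE mulr_gt0 ?expR_gt0 ?powR_gt0.
  rewrite lnM ?posrE ?expR_gt0 ?powR_gt0// expRK ln_powR.
  have -> : ln (\prod_(k < K) tnth p k) = \sum_(k < K) ln (tnth p k).
    elim: (index_enum _) => [|i s IH]; first by rewrite !big_nil ln1.
    by rewrite !big_cons lnM ?posrE ?prodr_gt0// IH.
  under [X in _ -> _ <= X]eq_bigr do rewrite ln_div ?posrE//.
  rewrite sumrN sumrB sumr_const card_ord -[ln eps *+ K]mulr_natl => h.
  have : K%:R * (1 + K%:R^-1 * \sum_(k < K) ln (tnth p k)) <= K%:R * ln eps by rewrite ler_pM2l.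
  by rewrite mulrDr mulr1 mulrA mulfV ?gt_eqF// mul1r; lra.
rewrite (mean_powE r1 r0 p01 hr); set S := \sum_(k < K) _; move=> le_eps.
have S0 : 0 <= S by apply: sumr_ge0 => k _; exact: powR_ge0.
have er : 0 < eps `^ r by rewrite powR_gt0.
have epsV : eps^-1 `^ r = (eps `^ r)^-1.
  by rewrite -(powR_inv1 (ltW eps0)) -powRrM mulN1r powRN.
have sumE : \sum_(k < K) - boxcox r (tnth p k / eps) = (K%:R - S / eps `^ r) / r.
  rewrite /boxcox (negbTE r0) sumrN -mulr_suml sumrB sumr_const card_ord -mulNr opprB.
  congr ((_ - _) / _); rewrite mulr_suml; apply: eq_bigr => k _.
  by rewrite powRM ?invr_ge0 ?(ltW eps0)// epsV.
rewrite sumE; set y := eps `^ r in er *.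
pose z := (r + 1) * (S / K%:R); pose t := K%:R / (r + 1).
have tK : K%:R = t * (r + 1) by rewrite /t divfK// gt_eqF.
have t0 : 0 < t by rewrite divr_gt0.
have SE : S / y = t * (z / y) by rewrite /t /z; field; rewrite !gt_eqF.
rewrite -/t SE {1}tK.
have [r_lt0|r_gt0|r0'] := ltgtP r 0; last by rewrite r0' eqxx in r0.
  have pp : forall k, 0 < tnth p k by case: hr => // /lt_trans/(_ r_lt0); rewrite ltxx.
  have z0 : 0 < z.
    rewrite mulr_gt0// divr_gt0// /S (bigD1 (Ordinal K0))//= ltr_pwDl ?powR_gt0//.
    by rewrite sumr_ge0// => k _; exact: powR_ge0.
  have yz : y <= z.
    have := @le0_powR r (z `^ r^-1) eps (ltW r_lt0); rewrite powR_gt0// => /(_ isT le_eps).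
    by rewrite -powRrM mulVf// powRr1// ltW.
  rewrite ler_ndivlMr//.
  have : t <= t * (z / y) by rewrite ler_peMr ?(ltW t0)// ler_pdivlMr// mul1r.
  by lra.
have zy : z <= y.
  have := @ge0_ler_powR _ r (ltW r_gt0) _ _ _ _ le_eps.
  rewrite !nnegrE powR_ge0 (ltW eps0) -powRrM mulVf// powRr1; first exact.
  by rewrite mulr_ge0 ?divr_ge0// ltW.
rewrite ler_pdivlMr//.
have : t * (z / y) <= t by rewrite ler_piMr ?(ltW t0)// ler_pdivrMr// mul1r.
by lra.
Qed.

Lemma mean_le_of_sum_powR r eps p : 0 < r -> 0 < eps -> unit_cube p ->
  \sum_(k < K) tnth p k `^ r <= eps `^ r * (K%:R / (r + 1)) ->
  mean_const r * gen_mean r p <= eps.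
Proof.
move=> r0 eps0 p01 hS; have rp : 0 < r + 1 by lra.
have r1 : -1 < r by lra.
rewrite (mean_powE r1 (lt0r_neq0 r0) p01 (or_introl r0)).
have epsE : eps = (eps `^ r) `^ r^-1 by rewrite -powRrM mulfV ?gt_eqF// powRr1// ltW.
rewrite [leRHS]epsE.
have S0 : 0 <= \sum_(k < K) tnth p k `^ r by apply: sumr_ge0 => k _; exact: powR_ge0.
rewrite ge0_ler_powR ?invr_ge0 ?nnegrE ?powR_ge0 ?mulr_ge0 ?divr_ge0 ?(ltW r0) ?(ltW rp)//.
rewrite mulrA ler_pdivrMr// mulrC -ler_pdivlMr//.
by rewrite mulrA in hS.
Qed.

Lemma measurable_unit_cube : measurable (@unit_cube R K).
Proof.
have -> : @unit_cube R K = \bigcap_(k in [set: 'I_K]) ((@tnth K R ^~ k) @^-1` `[0, 1]%classic).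
  apply/seteqP; split => p /= h k => [_|]; first by rewrite /= in_itv; exact: h.
  by have := h k I; rewrite /= in_itv.
apply: fin_bigcap_measurable => // k _; rewrite -[X in measurable X]setTI.
by apply: (@measurable_tnth _ R K k).
Qed.

Lemma measurable_mean r : measurable_fun (@unit_cube R K)
  (fun p : K.-tuple R => mean_const r * gen_mean r p).
Proof.
apply: measurable_funM; first exact: measurable_cst.
have mt k : measurable_fun setT (fun p : K.-tuple R => tnth p k) by exact: measurable_tnth.
have [r0|r0] := eqVneq r 0.
  apply: measurable_funTS; rewrite /gen_mean r0 eqxx.
  apply: (measurableT_comp (measurable_powR _)).
  by apply: measurable_prod => k _; exact: mt.
pose S (p : K.-tuple R) := ((\sum_(k < K) tnth p k `^ r) / K%:R) `^ r^-1.
have mS : measurable_fun setT S.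
  apply: (measurableT_comp (measurable_powR _)); apply: measurable_funM; last exact: measurable_cst.
  by apply: measurable_sum => k; apply: (measurableT_comp (measurable_powR _)).
apply: (@eq_measurable_fun _ _ _ _ _ (fun p => if (r < 0) && (\prod_(k < K) tnth p k == 0) then 0 else S p)).
  move=> p; rewrite inE => p01; case: ifP.
    by move=> /andP[r_lt0 /prodf_eq0[k _ /eqP pk]]; rewrite (gen_mean_zero r_lt0 pk).
  move=> /negbT; rewrite negb_and -leNgt => hr; rewrite /S gen_mean_real//.
  have [r_gt0|r_le0] := ltrP 0 r; [by left|right=> k].
  have r_lt0 : r < 0 by rewrite lt_neqAle r0.
  move: hr; rewrite leNgt r_lt0 /= => /prodf_neq0/(_ k isT) pk.
  by rewrite lt_neqAle eq_sym pk; case/andP: (p01 k).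
apply: measurable_funTS; apply: measurable_fun_ifT => //.
apply: measurable_and; first exact: measurable_cst.
apply: measurable_fun_eqr; last exact: measurable_cst.
by apply: measurable_prod => k _; exact: mt.
Qed.
End GeneralizedMean.

(** * Worst-case probabilities *)

Section WorstCase.
Context (R : realType) d (T : measurableType d) (P : probability T R).
Variables (r : R) (K : nat).
Hypotheses (r1 : -1 < r) (K2 : (2 <= K)%N).

Let F (p : K.-tuple R) : R := mean_const r * gen_mean r p.
Let K0 : (0 < K)%N. Proof. exact: ltnW. Qed.
Let KR : 0 < K%:R :> R. Proof. by rewrite ltr0n. Qed.
Let rp : 0 < r + 1. Proof. by rewrite -ltrBlDr sub0r. Qed.

Section Events.
Variable U : 'I_K -> {RV P >-> R}.
Hypothesis hU : forall k, uniform01 (U k).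

Lemma uniform_tuple_cube w : unit_cube [tuple U k w | k < K].
Proof. by move=> k; rewrite tnth_mktuple; case: (hU k). Qed.

Lemma measurable_mean_event eps :
  measurable [set w | F [tuple U k w | k < K] <= eps].
Proof.
pose X w : K.-tuple R := [tuple U k w | k < K].
have mX : measurable_fun setT X.
  apply/measurable_fun_tnthP => k.
  have -> : (@tnth K R)^~ k \o X = U k by apply/funext => w /=; rewrite tnth_mktuple.
  exact: (@measurable_funPT _ _ _ _ (U k)).
have -> : [set w | F (X w) <= eps] = X @^-1` (@unit_cube R K `&` F @^-1` `]-oo, eps]%classic).
  apply/seteqP; split => w /=; rewrite in_itv /=; last by case.
  by move=> h; split=> //; exact: uniform_tuple_cube.
rewrite -[X in measurable X]setTI; apply: mX => //.
by apply: (measurable_mean K0 r) => //; exact: measurable_unit_cube.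
Qed.

Lemma prob_mean_le eps a B : 0 < eps < 1 -> 0 < a < 1 -> 0 <= B ->
  (forall p : K.-tuple R, unit_cube p -> F p <= eps ->
     K%:R / (r + 1) <= \sum_k dual_test r eps a B (tnth p k)) ->
  (P [set w | (F [tuple U k w | k < K] <= eps)%R] <=
   ((r + 1) * (eps * (B * a + (r + 1)^-1 - boxcox_prim r a)))%:E)%E.
Proof.
move=> eps01 a01 B0 hF.
have b0 : 0 < K%:R / (r + 1) by rewrite divr_gt0.
have := @markov_uniform _ _ _ P K U (dual_test r eps a B) _ _ _ hU
  (measurable_dual_test r eps a B) (dual_test_ge0 r eps01 a01 B0)
  (integral_dual_test r1 eps01 a01 B0) b0 (measurable_mean_event eps).
rewrite boxcox_prim1// => h; apply: le_trans (h _) _.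
  move=> w /= /(hF _ (uniform_tuple_cube w)).
  by under [X in _ <= X -> _]eq_bigr do rewrite tnth_mktuple.
by rewrite lee_fin le_eqVlt; apply/orP; left; apply/eqP; field; rewrite !gt_eqF.
Qed.
End Events.

(** The truncation point a is where - boxcox r reaches K/(r+1); it exists exactly
    because r (K - 1) < 1.  A coordinate below eps a makes the sum large enough by
    itself, otherwise truncation changes nothing.  The expectation decreases by the
    factor 1 - a^(r+1). *)
Lemma prob_mean_lt : r * (K%:R - 1) < 1 -> exists2 th : R, 0 < th < 1 &
  forall (U : 'I_K -> {RV P >-> R}) eps, (forall k, uniform01 (U k)) -> 0 < eps < 1 ->
    (P [set w | (F [tuple U k w | k < K] <= eps)%R] <= (eps * th)%:E)%E.
Proof.
move=> rK; set b := K%:R / (r + 1).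
have b0 : 0 < b by rewrite divr_gt0.
have [a a0 ba] : exists2 a, 0 < a & boxcox r a = - b.
  rewrite /boxcox; case: eqVneq => [r0|r0].
    by exists (expR (- b)); rewrite ?expR_gt0// expRK.
  have base0 : 0 < 1 - r * b.
    rewrite subr_gt0 /b mulrA ltr_pdivrMr// mul1r; lra.
  exists ((1 - r * b) `^ r^-1); first by rewrite powR_gt0.
  by rewrite -powRrM mulVf// powRr1 ?(ltW base0)//; field.
have a1 : a < 1.
  by rewrite ltNge; apply/negP => /(boxcox_ge0 r); rewrite ba oppr_ge0 leNgt b0.
have a01 : 0 < a < 1 by rewrite a0.
have ar0 : 0 < a `^ (r + 1) by rewrite powR_gt0.
have ar1 : a `^ (r + 1) < 1.
  by apply: powR_lt1 => //; rewrite a1 ltW.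
exists (1 - a `^ (r + 1)); first by apply/andP; split; lra.
move=> U eps hU eps01; have /andP[eps0 _] := eps01.
have := @prob_mean_le U hU eps a b eps01 a01 (ltW b0); rewrite boxcox_primE// ba.
have -> : (r + 1) * (eps * (b * a + (r + 1)^-1 - (a `^ (r + 1) / (r + 1) - a * - b))) =
    eps * (1 - a `^ (r + 1)) by field; rewrite gt_eqF.
apply => p p01 Fp.
have dge0 k : 0 <= dual_test r eps a b (tnth p k) by exact: dual_test_ge0 eps01 a01 (ltW b0) _.
have [[k pk]|/forallNP big] := pselect (exists k, tnth p k <= eps * a).
  rewrite (bigD1 k)//= ler_wpDr ?sumr_ge0//; apply: dual_test_low => //.
  by rewrite pk andbT; case/andP: (p01 k).
have {}big k : eps * a < tnth p k by rewrite ltNge; apply/negP.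
have pp k : 0 < tnth p k by apply: lt_trans (big k); exact: mulr_gt0.
apply: le_trans (mean_le_sum_boxcox K0 r1 eps0 p01 (or_intror pp) Fp) _.
by apply: ler_sum => k _; apply: dual_test_high; rewrite ?(ltW b0) ?(ltW (big k)).
Qed.

(** For r (K - 1) >= 1 the function - boxcox r is bounded by 1/r, and the point a below
    which it is replaced by this bound tends to 0. *)
Lemma prob_mean_le_eps (U : 'I_K -> {RV P >-> R}) eps : (forall k, uniform01 (U k)) ->
  0 < eps < 1 -> (P [set w | (F [tuple U k w | k < K] <= eps)%R] <= eps%:E)%E.
Proof.
move=> hU eps01; have /andP[eps0 _] := eps01.
have [rK|rK] := ltrP (r * (K%:R - 1)) 1.
  have [th /andP[_ th1] h] := prob_mean_lt rK.
  by apply: le_trans (h U eps hU eps01) _; rewrite lee_fin ger_pMr// ltW.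
have r0 : 0 < r.
  rewrite ltNge; apply/negP => r0; move: rK; rewrite leNgt => /negP; apply.
  apply: le_lt_trans ltr01; rewrite mulr_le0_ge0// subr_ge0 ler1n//.
apply/lee_addgt0Pr => eta eta0; rewrite -EFinD.
pose a := Num.min 2^-1 (eta * r / eps).
have a0 : 0 < a by rewrite lt_min invr_gt0 ltr0n /= divr_gt0// mulr_gt0.
have a01 : 0 < a < 1.
  by rewrite a0 gt_min invf_lt1 ?ltr0n// ltr1n.
have ri0 : 0 <= r^-1 by rewrite invr_ge0 ltW.
apply: le_trans (prob_mean_le hU eps01 a01 ri0 _) _.
  move=> p p01 Fp; apply: le_trans (mean_le_sum_boxcox K0 r1 eps0 p01 (or_introl r0) Fp) _.
  apply: ler_sum => k _; have /andP[p0 _] := p01 k.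
  have [pa|pa] := lerP (eps * a) (tnth p k); first exact: dual_test_high.
  apply: (@le_trans _ _ r^-1); last by apply: dual_test_low => //; rewrite p0 ltW.
  rewrite /boxcox gt_eqF// -mulNr opprB -[leRHS]mul1r ler_pM2r ?invr_gt0//.
  by rewrite lerBlDr lerDl powR_ge0.
rewrite lee_fin boxcox_primE// /boxcox gt_eqF//.
have ar : a * a `^ r = a `^ (r + 1).
  by rewrite powRD ?powRr1 ?(ltW a0)// 1?mulrC// (lt0r_neq0 a0) implybT.
have -> : (r + 1) * (eps * (r^-1 * a + (r + 1)^-1 -
    (a `^ (r + 1) / (r + 1) - a * ((a `^ r - 1) / r)))) = eps + eps * (a `^ (r + 1) / r).
  by rewrite -ar; field; rewrite !gt_eqF.
rewrite lerD2l.
have : a `^ (r + 1) <= a.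
  by rewrite ge1r_powR ?lerDr ?(ltW r0)//; case/andP: a01 => -> /ltW.
have : a <= eta * r / eps by rewrite ge_min lexx orbT.
rewrite ler_pdivlMr// => h1 h2; rewrite mulrA ler_pdivrMr//.
by apply: le_trans h1; rewrite mulrC ler_pM2r.
Qed.

(** Any factor strictly between (K/(r+1))^(1/r) and 1 would do; this is the midpoint. *)
Lemma prob_mean_le_large (U : 'I_K -> {RV P >-> R}) eps : (forall k, uniform01 (U k)) ->
  0 < eps < 1 -> K%:R - 1 < r ->
  (P [set w | (F [tuple U k w | k < K] <= eps)%R] <=
   (eps * ((K%:R / (r + 1)) `^ r^-1 + 1) / 2)%:E)%E.
Proof.
move=> hU /andP[eps0 eps1] rK.
have r0 : 0 < r by apply: le_lt_trans rK; rewrite subr_ge0 ler1n.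
set c := K%:R / (r + 1); set y := eps * _ / 2.
have c0 : 0 <= c by rewrite divr_ge0// ltW.
have c1 : c < 1 by rewrite ltr_pdivrMr// mul1r; lra.
have ci1 : c `^ r^-1 < 1.
  by apply: powR_lt1; rewrite ?c0 ?c1// invr_gt0.
have ci0 : 0 <= c `^ r^-1 by exact: powR_ge0.
have lt_y : eps * c `^ r^-1 < y.
  by rewrite /y -mulrA ltr_pM2l//; lra.
have y01 : 0 <= y <= 1.
  have : y <= eps by rewrite /y -mulrA ger_pMr//; lra.
  by move=> ye; rewrite (le_trans _ (ltW lt_y)) ?mulr_ge0 ?(ltW eps0)//=; lra.
pose k0 := Ordinal K0.
have -> : y%:E = distribution P (U k0) `]-oo, y[%classic.
  have [_ ->] := hU k0; last exact: measurable_itv.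
  by case/andP: y01 => ? ?; rewrite uniform_prob_ray min_r// max_r.
apply: le_measure; rewrite ?inE//.
- exact: measurable_mean_event.
- by rewrite -[X in measurable X]setTI; apply: (@measurable_funPT _ _ _ _ (U k0)).
move=> w /= Fw; rewrite in_itv /=; apply: le_lt_trans lt_y.
have cube := uniform_tuple_cube hU w.
have := mean_le_sum_boxcox K0 r1 eps0 cube (or_introl r0) Fw.
under eq_bigr do rewrite tnth_mktuple.
have U0 k : 0 <= U k w by case: (hU k) => /(_ w) /andP[].
rewrite /boxcox gt_eqF// sumrN -mulr_suml sumrB sumr_const card_ord -mulNr opprB.
rewrite ler_pdivlMr// lerBrDr -lerBrDl => hsum.
have : (U k0 w / eps) `^ r <= c.
  apply: (@le_trans _ _ (\sum_k (U k w / eps) `^ r)).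
    by rewrite (bigD1 k0)//= lerDl sumr_ge0// => k _; exact: powR_ge0.
  apply: le_trans hsum _; rewrite -/c.
  have -> : K%:R = c * (r + 1) by rewrite /c divfK// gt_eqF.
  by lra.
move=> h; have ue0 : 0 <= U k0 w / eps by rewrite divr_ge0// ltW.
rewrite mulrC -ler_pdivrMr//.
have -> : U k0 w / eps = ((U k0 w / eps) `^ r) `^ r^-1.
  by rewrite -powRrM mulfV ?gt_eqF// powRr1.
by rewrite ge0_ler_powR ?invr_ge0 ?(ltW r0)// nnegrE// powR_ge0.
Qed.

(** The row sums exceed K/(r+1) by at most dl, which is chosen to be compensated by
    working on an event of probability e instead of eps. *)
Lemma prob_mean_ge eps e : atomless P -> (K%:R - 1)^-1 <= r <= K%:R - 1 ->
  0 < e < eps -> eps < 1 -> exists2 U : 'I_K -> {RV P >-> R},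
    (forall k, uniform01 (U k)) &
    (e%:E <= P [set w | (F [tuple U k w | k < K] <= eps)%R])%E.
Proof.
move=> hP rK /andP[e0 e_eps] eps1.
have eps0 : 0 < eps by exact: lt_trans e_eps.
have K1 : 0 < K%:R - 1 :> R by rewrite subr_gt0 ltr1n.
have r0 : 0 < r by case/andP: rK => + _; apply: lt_le_trans; rewrite invr_gt0.
have er0 : 0 < e `^ r by rewrite powR_gt0.
pose c := K%:R / (r + 1); have c0 : 0 < c by rewrite divr_gt0.
pose dl := (eps `^ r / e `^ r - 1) * c.
have dl0 : 0 < dl.
  rewrite mulr_gt0// subr_gt0 ltr_pdivlMr// mul1r gt0_ltr_powR// nnegrE ltW//.
have [m [pi [m0 pi_inj hpi]]] := latin_power_array K2 rK dl0.
have [U0 [mU0 U01 U0ray]] := exists_uniform hP.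
have e01 : 0 < e <= 1 by rewrite e0 (ltW (lt_trans e_eps eps1)).
have [V hV] := choice (fun k => interval_exchange mU0 U01 U0ray e01 m0 (pi_inj k)).
have V1 k : uniform01 (V k) by case: (hV k).
exists V => //.
rewrite -(U0ray e); last by case/andP: e01 => /ltW -> ->.
have mray : measurable [set w | U0 w < e].
  have -> : [set w | U0 w < e] = U0 @^-1` `]-oo, e[%classic.
    by apply/seteqP; split => w /=; rewrite in_itv.
  by rewrite -[X in measurable X]setTI; exact: mU0.
apply: le_measure; rewrite ?inE//; first exact: measurable_mean_event.
move=> w /= /(exists_cell U01 e01 m0)[i wi].
apply: (mean_le_of_sum_powR K0) => //; first exact: uniform_tuple_cube.
under eq_bigr do rewrite tnth_mktuple.
apply: (@le_trans _ _ (\sum_k e `^ r * ((pi k i).+1%:R / m%:R) `^ r)).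
  apply: ler_sum => k _; have [[V01 _] Vle] := hV k.
  rewrite -powRM ?divr_ge0 ?(ltW e0)// ge0_ler_powR ?(ltW r0) ?nnegrE ?mulr_ge0 ?divr_ge0 ?(ltW e0)//.
    by case/andP: (V01 w).
  exact: Vle.
rewrite -mulr_sumr; apply: (@le_trans _ _ (e `^ r * (c + dl))).
  by rewrite ler_pM2l// hpi.
rewrite -/c /dl le_eqVlt; apply/orP; left; apply/eqP; field.
by rewrite gt_eqF.
Qed.
End WorstCase.

Theorem proposition4 (R : realType) (d : measure_display)
    (T : measurableType d) (P : probability T R) (hP : atomless P)
    (r : R) (hr : -1 < r) (K : nat) (hK : (2 <= K)%N) :
  merging_function P (fun p : K.-tuple R => mean_const r * gen_mean r p) /\
  (precise P (fun p : K.-tuple R => mean_const r * gen_mean r p) <->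
   (K%:R - 1)^-1 <= r <= K%:R - 1).
Proof.
have K0 : (0 < K)%N by exact: ltnW.
have K1 : 0 < K%:R - 1 :> R by rewrite subr_gt0 ltr1n.
pose F (p : K.-tuple R) : R := mean_const r * gen_mean r p.
have upper eps : 0 < eps < 1 -> (worst_case_prob P F eps <= eps%:E)%E.
  by move=> eps01; apply: ge_ereal_sup => _ [U hU ->]; exact: prob_mean_le_eps.
have not_precise (x : R) : x < 2^-1 ->
    (forall U : 'I_K -> {RV P >-> R}, (forall k, uniform01 (U k)) ->
      (P [set w | (F [tuple U k w | k < K] <= 2^-1)%R] <= x%:E)%E) ->
    ~ precise P F.
  move=> x1 hx /(_ 2^-1); rewrite invr_gt0 ltr0n invf_lt1 ?ltr0n// ltr1n => /(_ isT) eq.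
  suff : (2^-1%:E <= x%:E :> \bar R)%E by rewrite lee_fin leNgt x1.
  by rewrite -eq; apply: ge_ereal_sup => _ [U hU ->]; exact: hx.
have half01 : 0 < (2^-1 : R) < 1 by apply/andP; split; lra.
split.
  split => //.
  - exact: measurable_mean.
  - by move=> p _; rewrite mulr_ge0 ?mean_const_ge0 ?gen_mean_ge0.
  - move=> p q k p01 q01 pq pqk; rewrite ler_wpM2l ?mean_const_ge0//.
    apply: gen_mean_le => // j; have [->//|jk] := eqVneq j k.
    by rewrite pq.
split => [hprec|rK].
  apply/andP; split; rewrite leNgt; apply/negP => rK.
    have [|th /andP[_ th1] hth] := prob_mean_lt P hr hK.
      by rewrite -ltr_pdivlMr// div1r.
    apply: (not_precise (2^-1 * th)) hprec; first by rewrite gtr_pMr ?invr_gt0.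
    by move=> U hU; exact: hth.
  apply: (not_precise (2^-1 * ((K%:R / (r + 1)) `^ r^-1 + 1) / 2)) hprec.
    have r0 : 0 < r by apply: lt_trans rK.
    have : (K%:R / (r + 1)) `^ r^-1 < 1.
      have rp : 0 < r + 1 by lra.
      apply: powR_lt1; last by rewrite invr_gt0.
      by rewrite divr_ge0 ?(ltW rp)//= ltr_pdivrMr// mul1r; lra.
    by lra.
  by move=> U hU; exact: prob_mean_le_large.
move=> eps eps01; apply/eqP; rewrite eq_le upper//=.
rewrite leNgt; apply/negP => lt.
have /andP[eps0 eps1] := eps01.
have lower e : 0 < e < eps -> (e%:E <= worst_case_prob P F eps)%E.
  move=> e01; have [U hU hge] := prob_mean_ge hr hK hP rK e01 eps1.
  by apply: le_trans hge _; apply: ereal_sup_ubound; exists U.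
move: lt lower; case: (worst_case_prob P F eps) => [x| |] //= lt lower.
  rewrite lte_fin in lt.
  have h1 : eps / 2 <= x by rewrite -lee_fin lower//; apply/andP; split; lra.
  have : (x + eps) / 2 <= x by rewrite -lee_fin lower//; apply/andP; split; lra.
  by lra.
by have := lower (eps / 2); rewrite leNgt ltNyr => h; apply: notF; apply: h; lra.
Qed.
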